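(* Let $a\in\mathbb{I}_1\setminus F$ and $d:=\deg_F(a)$. Then (1) $a_{K[x]}\in\mathrm{Aut}_K(K[x])$ iff $a=\sum_{i\ge1}a_{-i}\partial^i+a_0+\sum_{i,j\in\mathbb{N}}\lambda_{ij}e_{ij}$ (canonical form, i.e. with no terms $\int^ia_i$, $i>0$), $b:=a|_{K[x]_{\le d}}\in\mathrm{GL}(K[x]_{\le d})$, and $s+1$ is not a root of the nonzero polynomial $a_0\in K[H]$ for all natural numbers $s>d$. (2) $\mathbb{I}_1^0:=\mathbb{I}_1\cap\mathrm{Aut}_K(K[x])\supsetneqq\mathbb{I}_1^*=K^*(1+F)^*$. (3) If $\mathrm{ind}_{K[x]}(a)=0$ then the following statements are equivalent: (a) $a_{K[x]}$ is an injection; (b) $a_{K[x]}$ is a surjection; (c) $a_{K[x]}$ is a bijection. (4) (Inversion Formula) Suppose that $a_{K[x]}\in\mathrm{Aut}_K(K[x])$, $a=a_-+a_0+\sum\lambda_{ij}e_{ij}$ where $a_-=\sum_{i\ge1}a_{-i}\partial^i$. Then according to the decomposition $K[x]=K[x]_{\le d}\oplus K[x]_{>d}$, where $K[x]_{>d}:=\bigoplus_{i>d}Kx^i$ (identified with $K[x]/K[x]_{\le d}$), the map $a_{K[x]}$ is the matrix $\begin{pmatrix}a_{11}&a_{12}\\0&a_{22}\end{pmatrix}$ where $a_{11}:=a|_{K[x]_{\le d}}$, $a_{22}:=a|_{K[x]/K[x]_{\le d}}=(a_-+a_0)|_{K[x]/K[x]_{\le d}}$, the matrix of the linear map $a_{12}:K[x]/K[x]_{\le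 d}\to K[x]_{\le d}$ has only a finite number of nonzero entries with respect to the monomial bases of the vector spaces, and $$\begin{pmatrix}a_{11}&a_{12}\\0&a_{22}\end{pmatrix}^{-1}=\begin{pmatrix}a_{11}^{-1}&-a_{11}^{-1}a_{12}a_{22}^{-1}\\0&a_{22}^{-1}\end{pmatrix}$$ where $a_{22}^{-1}=\sum_{i\ge0}(-1)^i(a_0^{-1}a_-)^ia_0^{-1}$ (here $a_0^{-1}a_-$ is a locally nilpotent map on the vector space $K[x]/K[x]_{\le d}$).
   Context: $K$ is a field of characteristic zero, $\mathbb{N}=\{0,1,\ldots\}$. $\mathbb{I}_1$ is the subalgebra of $\mathrm{End}_K(K[x])$ generated by (multiplication by) $x$, $\partial=\frac{d}{dx}$ and $\int: x^n\mapsto \frac{x^{n+1}}{n+1}$; $\mathbb{I}_1^*$ is its group of units. Put $H:=\partial x$ (so $H*x^n=(n+1)x^n$), $e_{ij}:=\int^i\partial^j-\int^{i+1}\partial^{j+1}$ and $F:=\bigoplus_{i,j\ge0}Ke_{ij}$, an ideal of $\mathbb{I}_1$. $(1+F)^*$ is the group of units of the multiplicative monoid $1+F$. Each $a\in\mathbb{I}_1$ is a unique finite sum (canonical form) $a=\sum_{i>0}a_{-i}\partial^i+a_0+\sum_{i>0}\int^ia_i+\sum_{i,j\in\mathbb{N}}\lambda_{ij}e_{ij}$ with $a_k\in K[H]$, $\lambda_{ij}\in K$. With $a_F:=\sum\lambda_{ij}e_{ij}$, $\deg_F(a):=\min\{n\in\mathbb{N}\mid a_F\in\bigoplus_{i,j=0}^nKe_{ij}\}$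 if $a_F\ne0$, and $\deg_F(a):=-1$ if $a_F=0$. $K[x]_{\le d}:=\bigoplus_{i=0}^dKx^i$ (zero for $d=-1$). $a_{K[x]}:K[x]\to K[x]$, $p\mapsto ap$; $\mathrm{Aut}_K(K[x])$ is the group of invertible $K$-linear maps of $K[x]$. For $a\in\mathbb{I}_1\setminus F$, $\mathrm{ind}_{K[x]}(a):=\dim_K\ker(a_{K[x]})-\dim_K\mathrm{coker}(a_{K[x]})$ (both dimensions are finite). A linear map $\varphi$ on $V$ is locally nilpotent if for each $v\in V$ one has $\varphi^iv=0$ for some $i\geq 1$. *)

(* Defs.v *)
From HB Require Import structures.
From mathcomp Require Import all_boot all_order all_algebra.
From mathcomp Require Export finmap.
From mathcomp Require Export boolp classical_sets cardinality.

Set Implicit Arguments.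
Unset Strict Implicit.
Unset Printing Implicit Defensive.

Import Order.TTheory GRing.Theory Num.Theory.
Local Open Scope ring_scope.
Local Open Scope classical_set_scope.

Section LinearMaps.
Variables (K : fieldType) (U V : lmodType K).

Definition lin_inverse (f : {linear U -> V}) (g : {linear V -> U}) : Prop :=
  cancel f g /\ cancel g f.

Definition lin_invertible (f : {linear U -> V}) : Prop :=
  exists g : {linear V -> U}, lin_inverse f g.

Definition locally_nilpotent (f : V -> V) : Prop :=
  forall v, exists2 i : nat, (0 < i)%N & iter i f v = 0.

(* [g] is the sum of the locally finite family [f]. *)
Definition is_locally_finite_sum (f : nat -> U -> V) (g : U -> V) : Prop :=
  forall u, exists N : nat,
    (forall i, (N <= i)%N -> f i u = 0) /\ g u = \sum_(i < N) f i u.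

(* For subspaces [W `<=` A] of [V]: some family of [n] vectors of [A] is a
   basis of the quotient [A / W]. *)
Definition is_dim_quot (A W : set V) (n : nat) : Prop :=
  exists b : 'I_n -> V, (forall i, A (b i)) /\
    forall v, A v ->
      exists! c : {ffun 'I_n -> K}, W (v - \sum_(i < n) c i *: b i).

(* Meaningful only when [A / W] is finite dimensional. *)
Definition dim_quot (A W : set V) : nat := xget 0%N [set n | is_dim_quot A W n].

End LinearMaps.

Section Endomorphisms.
Variable K : fieldType.

Definition Endo : Type := {linear {poly K} -> {poly K}}.
Implicit Types f g h : Endo.

HB.instance Definition _ := gen_eqMixin Endo.
HB.instance Definition _ := gen_choiceMixin Endo.

Lemma EndoP f g : f =1 g -> f = g.
Proof.
case: f g => f [[Hf] [Hf']] [g [[Hg] [Hg']]] /= /funext fg; subst g.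
by congr (GRing.Linear.Pack (GRing.Linear.Class _ _)); congr (_ _); exact: Prop_irrelevance.
Qed.

Definition Endo_zero : Endo := \0.
Definition Endo_opp f : Endo := \- f.
Definition Endo_add f g : Endo := f \+ g.
Definition Endo_one : Endo := idfun.
Definition Endo_mul f g : Endo := f \o g.
Definition Endo_scale (k : K) f : Endo := k \*: f.

Fact Endo_addA : associative Endo_add.
Proof. by move=> f g h; apply: EndoP => p; rewrite /= addrA. Qed.
Fact Endo_addC : commutative Endo_add.
Proof. by move=> f g; apply: EndoP => p; rewrite /= addrC. Qed.
Fact Endo_add0 : left_id Endo_zero Endo_add.
Proof. by move=> f; apply: EndoP => p; rewrite /= add0r. Qed.
Fact Endo_addN : left_inverse Endo_zero Endo_opp Endo_add.
Proof. by move=> f; apply: EndoP => p; rewrite /= addNr. Qed.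
HB.instance Definition _ :=
  GRing.isZmodule.Build Endo Endo_addA Endo_addC Endo_add0 Endo_addN.

Fact Endo_mulA : associative Endo_mul.
Proof. by move=> f g h; apply: EndoP. Qed.
Fact Endo_mul1 : left_id Endo_one Endo_mul.
Proof. by move=> f; apply: EndoP. Qed.
Fact Endo_mulr1 : right_id Endo_one Endo_mul.
Proof. by move=> f; apply: EndoP. Qed.
Fact Endo_mulDl : left_distributive Endo_mul Endo_add.
Proof. by move=> f g h; apply: EndoP. Qed.
Fact Endo_mulDr : right_distributive Endo_mul Endo_add.
Proof. by move=> f g h; apply: EndoP => p; rewrite /= linearD. Qed.
Fact Endo_one_neq0 : Endo_one != 0 :> Endo.
Proof.
by apply/eqP => /(congr1 (fun f : Endo => f 1)) /= /eqP; rewrite oner_eq0.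
Qed.
HB.instance Definition _ := GRing.Zmodule_isNzRing.Build Endo
  Endo_mulA Endo_mul1 Endo_mulr1 Endo_mulDl Endo_mulDr Endo_one_neq0.

Fact Endo_scaleA k l f : Endo_scale k (Endo_scale l f) = Endo_scale (k * l) f.
Proof. by apply: EndoP => p; rewrite /= scalerA. Qed.
Fact Endo_scale1 : left_id 1 Endo_scale.
Proof. by move=> f; apply: EndoP => p; rewrite /= scale1r. Qed.
Fact Endo_scaleDr : right_distributive Endo_scale +%R.
Proof. by move=> k f g; apply: EndoP => p; rewrite /= scalerDr. Qed.
Fact Endo_scaleDl f : {morph Endo_scale^~ f : k l / k + l}.
Proof. by move=> k l; apply: EndoP => p; rewrite /= scalerDl. Qed.
HB.instance Definition _ := GRing.Zmodule_isLmodule.Build K Endo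
  Endo_scaleA Endo_scale1 Endo_scaleDr Endo_scaleDl.

Fact Endo_scaleAl k f g : k *: (f * g) = (k *: f) * g.
Proof. by apply: EndoP. Qed.
HB.instance Definition _ := GRing.Lmodule_isLalgebra.Build K Endo Endo_scaleAl.

Fact Endo_scaleAr k f g : k *: (f * g) = f * (k *: g).
Proof. by apply: EndoP => p; rewrite /GRing.mul/= linearZ. Qed.
HB.instance Definition _ := GRing.Lalgebra_isAlgebra.Build K Endo Endo_scaleAr.

Definition units (M : set Endo) : set Endo :=
  [set f | M f /\ exists2 g, M g & f * g = 1 /\ g * f = 1].

Definition Aut : set Endo := [set f | lin_invertible f].

Definition dim_ker f : nat := dim_quot [set p | f p = 0] [set 0].
Definition dim_coker f : nat := dim_quot [set: {poly K}] (range f).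
Definition ind f : int := (dim_ker f)%:Z - (dim_coker f)%:Z.

End Endomorphisms.

Arguments Aut K : clear implicits.

Section IntegroDifferential.
Variable K : fieldType.

Definition mulX (p : {poly K}) : {poly K} := 'X * p.

Fact mulX_linear : linear mulX.
Proof. by move=> k p q; rewrite /mulX mulrDr scalerAr. Qed.
HB.instance Definition _ :=
  GRing.isLinear.Build K {poly K} {poly K} _ mulX mulX_linear.

Definition integ (p : {poly K}) : {poly K} :=
  \sum_(n < size p) (p`_n / n.+1%:R) *: 'X^(n.+1).

Fact coef_integ p i : (integ p)`_i = if i is j.+1 then p`_j / j.+1%:R else 0.
Proof.
rewrite /integ coef_sum; case: i => [|j].
  by rewrite big1 // => n _; rewrite coefZ coefXn mulr0.
have [jp|pj] := ltnP j (size p); last first.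
  rewrite nth_default // mul0r big1 // => n _; rewrite coefZ coefXn eqSS.
  by rewrite gtn_eqF ?mulr0 // (leq_trans (ltn_ord n)).
rewrite (bigD1 (Ordinal jp)) //= coefZ coefXn eqxx mulr1 big1 ?addr0 // => n nj.
by rewrite coefZ coefXn eqSS eq_sym -val_eqE in nj *; rewrite (negPf nj) mulr0.
Qed.

Fact integ_linear : linear integ.
Proof.
move=> k p q; apply/polyP => -[|j]; rewrite coefD coefZ !coef_integ.
  by rewrite mulr0 addr0.
by rewrite coefD coefZ mulrDl mulrA.
Qed.
HB.instance Definition _ :=
  GRing.isLinear.Build K {poly K} {poly K} _ integ integ_linear.

Definition opX : Endo K := mulX.
Definition opD : Endo K := @deriv K.
Definition opI : Endo K := integ.
Definition opH : Endo K := opD * opX.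

Definition I1 : set (Endo K) :=
  smallest (fun S : set (Endo K) => GRing.subalg_closed [in S])
    [set opX; opD; opI].

Definition e (i j : nat) : Endo K :=
  opI ^+ i * opD ^+ j - opI ^+ i.+1 * opD ^+ j.+1.

Definition Fsum (lam : {fsfun nat * nat -> K with 0}) : Endo K :=
  \sum_(ij <- finsupp lam) lam ij *: e ij.1 ij.2.

Definition F : set (Endo K) := range Fsum.

Definition oneF : set (Endo K) := [set 1 + f | f in F].

(* The element [p(H)] of [K[H]] is encoded by the polynomial [p]. *)
Definition atH (p : {poly K}) : Endo K := horner_alg opH p.

(* The term of degree [k] of a canonical form; [Negz i] is [- i.+1]. *)
Definition cf_term (k : int) (p : {poly K}) : Endo K :=
  match k with
  | Posz i => opI ^+ i * atH p
  | Negz i => atH p * opD ^+ i.+1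
  end.

(* The coefficients [(a_k, lambda_ij)] of a canonical form. *)
Definition cf : Type :=
  ({fsfun int -> {poly K} with 0} * {fsfun nat * nat -> K with 0})%type.

Definition cf_eval (cl : cf) : Endo K :=
  \sum_(k <- finsupp cl.1) cf_term k (cl.1 k) + Fsum cl.2.

(* The canonical form of [a]; it exists and is unique for [a] in [I1]. *)
Definition canform (a : Endo K) : cf :=
  xget ([fsfun], [fsfun]) [set cl | cf_eval cl = a].

Definition coefH (a : Endo K) (k : int) : {poly K} := (canform a).1 k.

Definition part_minus (a : Endo K) : Endo K :=
  \sum_(k <- finsupp (canform a).1 | k < 0) cf_term k (coefH a k).
Definition part_zero (a : Endo K) : Endo K := atH (coefH a 0).
Definition part_F (a : Endo K) : Endo K := Fsum (canform a).2.

Definition F_le (n : nat) : set (Endo K) :=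
  range (fun lam : 'M[K]_n.+1 =>
    \sum_(i < n.+1) \sum_(j < n.+1) lam i j *: e i j).

Definition min_nat (P : set nat) : nat :=
  xget 0%N [set n | P n /\ forall m, P m -> (n <= m)%N].

Definition degF (a : Endo K) : int :=
  if part_F a == 0 then -1 else (min_nat [set n | F_le n (part_F a)])%:Z.

End IntegroDifferential.

Arguments I1 K : clear implicits.
Arguments F K : clear implicits.
Arguments oneF K : clear implicits.

Section Blocks.
Variables (K : fieldType) (d : int).
Implicit Types p q : {poly K}.

Definition in_le (p : {poly K}) : bool :=
  [forall i : 'I_(size p), (p`_i != 0) ==> ((i : nat)%:Z <= d)].
Definition in_gt (p : {poly K}) : bool :=
  [forall i : 'I_(size p), (p`_i != 0) ==> (d < (i : nat)%:Z)].

Fact in_leP p : reflect (forall i : nat, d < i%:Z -> p`_i = 0) (in_le p).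
Proof.
apply: (iffP forallP) => [H i di|H i].
  have [ip|] := ltnP i (size p); last exact: nth_default.
  apply/eqP; apply: contraTT di => pi0.
  by rewrite -leNgt; apply: (implyP (H (Ordinal ip))).
by apply/implyP; apply: contraTT; rewrite -ltNge => /H ->; rewrite negbK.
Qed.

Fact in_gtP p : reflect (forall i : nat, i%:Z <= d -> p`_i = 0) (in_gt p).
Proof.
apply: (iffP forallP) => [H i di|H i].
  have [ip|] := ltnP i (size p); last exact: nth_default.
  apply/eqP; apply: contraTT di => pi0.
  by rewrite -ltNge; apply: (implyP (H (Ordinal ip))).
by apply/implyP; apply: contraTT; rewrite -leNgt => /H ->; rewrite negbK.
Qed.

Fact in_le_submod : GRing.submod_closed in_le.
Proof.
split=> [|k p q /in_leP Hp /in_leP Hq]; apply/in_leP => i di.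
  by rewrite coef0.
by rewrite coefD coefZ Hp // Hq // mulr0 addr0.
Qed.
HB.instance Definition _ :=
  GRing.isSubmodClosed.Build K {poly K} in_le in_le_submod.

Fact in_gt_submod : GRing.submod_closed in_gt.
Proof.
split=> [|k p q /in_gtP Hp /in_gtP Hq]; apply/in_gtP => i di.
  by rewrite coef0.
by rewrite coefD coefZ Hp // Hq // mulr0 addr0.
Qed.
HB.instance Definition _ :=
  GRing.isSubmodClosed.Build K {poly K} in_gt in_gt_submod.

Record pol_le := PolLe { pol_le_val : {poly K}; _ : in_le pol_le_val }.
HB.instance Definition _ := [isSub for pol_le_val].
HB.instance Definition _ := [Choice of pol_le by <:].
HB.instance Definition _ := [SubChoice_isSubLmodule of pol_le by <:].

(* [K[x]_{>d}], which also stands for the quotient [K[x] / K[x]_{<=d}]; the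
   canonical projection onto the latter is [proj_gt] below. *)
Record pol_gt := PolGt { pol_gt_val : {poly K}; _ : in_gt pol_gt_val }.
HB.instance Definition _ := [isSub for pol_gt_val].
HB.instance Definition _ := [Choice of pol_gt by <:].
HB.instance Definition _ := [SubChoice_isSubLmodule of pol_gt by <:].

Definition trunc_le (p : {poly K}) : {poly K} :=
  \poly_(i < size p) (if i%:Z <= d then p`_i else 0).
Definition trunc_gt (p : {poly K}) : {poly K} :=
  \poly_(i < size p) (if d < i%:Z then p`_i else 0).

Fact coef_trunc_le p i : (trunc_le p)`_i = if i%:Z <= d then p`_i else 0.
Proof. by rewrite coef_poly; case: ltnP => // /(nth_default 0) ->; rewrite if_same. Qed.
Fact coef_trunc_gt p i : (trunc_gt p)`_i = if d < i%:Z then p`_i else 0.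
Proof. by rewrite coef_poly; case: ltnP => // /(nth_default 0) ->; rewrite if_same. Qed.

Fact trunc_le_in p : in_le (trunc_le p).
Proof. by apply/in_leP => i di; rewrite coef_trunc_le leNgt di. Qed.
Fact trunc_gt_in p : in_gt (trunc_gt p).
Proof. by apply/in_gtP => i di; rewrite coef_trunc_gt ltNge di. Qed.

Definition proj_le (p : {poly K}) : pol_le := PolLe (trunc_le_in p).
Definition proj_gt (p : {poly K}) : pol_gt := PolGt (trunc_gt_in p).

Fact proj_le_linear : linear proj_le.
Proof.
move=> k p q; apply: val_inj; rewrite linearD linearZ; apply/polyP => i /=.
by rewrite coefD coefZ !coef_trunc_le coefD coefZ; case: ifP; rewrite ?mulr0 ?addr0.
Qed.
HB.instance Definition _ :=
  GRing.isLinear.Build K {poly K} pol_le _ proj_le proj_le_linear.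

Fact proj_gt_linear : linear proj_gt.
Proof.
move=> k p q; apply: val_inj; rewrite linearD linearZ; apply/polyP => i /=.
by rewrite coefD coefZ !coef_trunc_gt coefD coefZ; case: ifP; rewrite ?mulr0 ?addr0.
Qed.
HB.instance Definition _ :=
  GRing.isLinear.Build K {poly K} pol_gt _ proj_gt proj_gt_linear.

Definition restricts_to (f : Endo K) (g : pol_le -> pol_le) : Prop :=
  forall v, val (g v) = f (val v).

(* [f] induces the map [g] on the quotient [K[x] / K[x]_{<=d}]. *)
Definition induces (f : Endo K) (g : pol_gt -> pol_gt) : Prop :=
  forall p, g (proj_gt p) = proj_gt (f p).

Definition block11 (f : Endo K) : {linear pol_le -> pol_le} :=
  proj_le \o f \o val.
Definition block12 (f : Endo K) : {linear pol_gt -> pol_le} :=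
  proj_le \o f \o val.
Definition block22 (f : Endo K) : {linear pol_gt -> pol_gt} :=
  proj_gt \o f \o val.

(* The endomorphism of [K[x] = K[x]_{<=d} (+) K[x]_{>d}] with the given 2 x 2
   matrix. *)
Definition block_map (f11 : {linear pol_le -> pol_le})
    (f12 : {linear pol_gt -> pol_le}) (f21 : {linear pol_le -> pol_gt})
    (f22 : {linear pol_gt -> pol_gt}) : Endo K :=
  (val \o ((f11 \o proj_le) \+ (f12 \o proj_gt)))
  \+ (val \o ((f21 \o proj_le) \+ (f22 \o proj_gt))).

End Blocks.

(* Main.v *)
Require Import Defs.
From HB Require Import structures.
From mathcomp Require Import all_boot all_order all_algebra.
From mathcomp Require Import zify ring.

(** Write an operator in the basis of divided powers y_n = x^n / n!.  There
    [opI] and [opD] are the two shifts, H multiplies y_n by n + 1, and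
    e_ij is a matrix unit.  Hence the operator with canonical form
    (a_k, lambda) has (i, n) entry
        a_{i-n}(min(i, n) + 1) + lambda_in,
    a finite perturbation of a banded matrix that is polynomial along each
    diagonal ([entry_cf_eval]).  Conversely, being eventually banded with
    polynomial diagonals is stable under linear combinations and products and
    holds for the three generators, so every element of [I1] is the value of
    its canonical form ([canformK]); the ideal [F] consists of the operators
    that kill almost all y_n ([F_dpowP]).

    If a is not in [F], let m be the largest index with a_m <> 0.  As a_m has
    finitely many natural roots, for N large a maps polynomials of degree < N
    to polynomials of degree < N + m and raises every degree >= N by exactly m
    ([shifts], [cf_shifts]).  So kernel and cokernel of a are those of a finite
    matrix of format N x (N + m).  They are finite dimensional, which gives
    (3) ([ind0_inj_surj]), and if a is bijective then m = 0, so the canonical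
    form has no integration terms and a_0 <> 0 ([Aut_coefH]).

    For (1), an operator without integration terms is triangular outside the
    corner of size d + 1, with diagonal entries a_0(s + 1) for s > d.  If a is
    injective, a zero diagonal entry would send the polynomials of degree <= s
    into those of degree < s; conversely an invertible corner and nonzero
    diagonal entries give bijectivity by induction on the degree.

    For (2), let u and v be inverse to each other in [I1].  Both are
    automorphisms, so their indices are <= 0; the entries of u v on its lowest
    diagonal are products of values of the lowest coefficients of u and v,
    nonzero far from the corner, while u v = 1 is diagonal.  So u and v only
    have the coefficients u_0 and v_0, and u_0 v_0 = 1 makes u_0 a
    constant ([unit_scalar_mod_F]).  The operator H shows that the inclusion
    is strict.

    For (4), the decomposition of K[x] is triangular for a and its inverse, so
    the blocks of the inverse are given by the usual formula for triangular
    2 x 2 matrices.  The map induced by a_- lowers degrees and the one induced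
    by a_0 is diagonal and invertible, so the inverse of their sum is a locally
    finite Neumann series ([neumann_series]). *)

Set Implicit Arguments.
Unset Strict Implicit.
Unset Printing Implicit Defensive.

Import Order.TTheory GRing.Theory Num.Theory.
Local Open Scope ring_scope.
Local Open Scope classical_set_scope.

(** * Divided powers and matrix entries *)

(** Divided powers: on this basis integration and differentiation are plain
    shifts, with no numerical factors. *)
HB.lock Definition dpow (K : fieldType) (n : nat) : {poly K} :=
  n`!%:R^-1 *: 'X^n.

Section Coordinates.
Variable K : fieldType.
Hypothesis charK : [pchar K] =i pred0.
Implicit Types (f g : Endo K) (p q : {poly K}).

Lemma natf_neq0S n : n.+1%:R != 0 :> K.
Proof. by rewrite (pcharf0P K).1. Qed.

Lemma factf_neq0 n : n`!%:R != 0 :> K.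
Proof. by rewrite (pcharf0P K).1 // -lt0n fact_gt0. Qed.

Lemma natf_inj m n : m%:R = n%:R :> K -> m = n.
Proof.
wlog mn : m n / (m <= n)%N.
  by move=> W; case/orP: (leq_total m n) => [/W //|/W W' /esym /W' ->].
move=> /eqP; rewrite -(subnKC mn) natrD -[X in X == _]addr0 (inj_eq (addrI _)).
by rewrite eq_sym (pcharf0P K).1 // => /eqP ->; rewrite addn0.
Qed.

Lemma EndoDE f g p : (f + g) p = f p + g p. Proof. by []. Qed.
Lemma EndoME f g p : (f * g) p = f (g p). Proof. by []. Qed.
Lemma EndoZE k f p : (k *: f) p = k *: f p. Proof. by []. Qed.
Lemma Endo1E p : (1 : Endo K) p = p. Proof. by []. Qed.
Lemma EndoBE f g p : (f - g) p = f p - g p. Proof. by []. Qed.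
Lemma Endo_sumE I (r : seq I) (P : pred I) (G : I -> Endo K) p :
  (\sum_(i <- r | P i) G i) p = \sum_(i <- r | P i) G i p.
Proof. exact: (big_morph (fun f : Endo K => f p)). Qed.

(** The coordinates with respect to the basis of divided powers. *)
Definition dcoord i p : K := p`_i * i`!%:R.

Definition entry f i n : K := dcoord i (f (dpow K n)).

Fact dcoord_linear i : linear_for *%R (dcoord i).
Proof. by move=> k p q; rewrite /dcoord coefD coefZ; ring. Qed.
HB.instance Definition _ i :=
  GRing.isLinear.Build K {poly K} K _ (dcoord i) (dcoord_linear i).

Lemma dcoordZ i k p : dcoord i (k *: p) = k * dcoord i p.
Proof. exact: linearZ. Qed.

Lemma dcoordB i p q : dcoord i (p - q) = dcoord i p - dcoord i q.
Proof. exact: linearB. Qed.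

Lemma dcoord_dpow i n : dcoord i (dpow K n) = (i == n)%:R.
Proof.
rewrite /dcoord dpow.unlock coefZ coefXn.
case: eqP => [->|_]; last by rewrite mulr0 mul0r.
by rewrite mulr1 mulVf ?factf_neq0.
Qed.

Lemma dcoordP p q : (forall i, dcoord i p = dcoord i q) -> p = q.
Proof. by move=> pq; apply/polyP => i; apply: (mulIf (factf_neq0 i)); apply: pq. Qed.

Lemma dcoord_eq0 i p : (dcoord i p == 0) = (p`_i == 0).
Proof. by rewrite mulf_eq0 (negPf (factf_neq0 i)) orbF. Qed.

Lemma size_dcoordP N p :
  reflect (forall i, (N <= i)%N -> dcoord i p = 0) (size p <= N)%N.
Proof.
apply: (iffP (leq_sizeP _ _)) => H i /H /eqP h; apply/eqP; move: h;
  by rewrite dcoord_eq0.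
Qed.

Lemma dpow_expansion N p :
  (size p <= N)%N -> p = \sum_(n < N) dcoord n p *: dpow K n.
Proof.
move=> pN; apply: dcoordP => i; rewrite linear_sum /=.
rewrite (eq_bigr (fun n : 'I_N => if i == n then dcoord n p else 0)); last first.
  by move=> n _; rewrite linearZ /= dcoord_dpow mulr_natr mulrb.
have [iN|Ni] := ltnP i N.
  rewrite (bigD1 (Ordinal iN)) //= eqxx big1 ?addr0 // => n.
  by rewrite -val_eqE /= eq_sym => /negPf ->.
rewrite big1 => [|n _]; first exact/(size_dcoordP _ _ pN).
by rewrite gtn_eqF // (leq_trans (ltn_ord n)).
Qed.

Lemma dcoord_apply N f p i : (size p <= N)%N ->
  dcoord i (f p) = \sum_(n < N) dcoord n p * entry f i n.
Proof.
move=> pN; rewrite {1}(dpow_expansion pN) !linear_sum /=.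
by apply: eq_bigr => n _; rewrite 2!linearZ.
Qed.

Lemma Endo_entryP f g : (forall i n, entry f i n = entry g i n) -> f = g.
Proof.
move=> fg; apply: EndoP => p; apply: dcoordP => i.
by rewrite !(dcoord_apply _ _ (leqnn _)); apply: eq_bigr => n _; rewrite fg.
Qed.

Lemma Endo_dpowP f g : (forall n, f (dpow K n) = g (dpow K n)) -> f = g.
Proof. by move=> fg; apply: Endo_entryP => i n; rewrite /entry fg. Qed.

Lemma entryD f g i n : entry (f + g) i n = entry f i n + entry g i n.
Proof. by rewrite /entry EndoDE linearD. Qed.

Lemma entryZ k f i n : entry (k *: f) i n = k * entry f i n.
Proof. by rewrite /entry EndoZE linearZ. Qed.

Lemma entry_sum I (r : seq I) (P : pred I) (G : I -> Endo K) i n :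
  entry (\sum_(j <- r | P j) G j) i n = \sum_(j <- r | P j) entry (G j) i n.
Proof. by rewrite /entry Endo_sumE linear_sum. Qed.

Lemma opD_dpow n : opD K (dpow K n.+1) = dpow K n.
Proof.
rewrite /opD /= dpow.unlock linearZ /= derivXn -scaler_nat scalerA; congr (_ *: _).
by rewrite factS natrM invfM mulrAC mulVf ?mul1r ?natf_neq0S.
Qed.

Lemma opD_dpow0 : opD K (dpow K 0) = 0.
Proof. by rewrite /opD /= dpow.unlock linearZ /= expr0 derivC scaler0. Qed.

Lemma opI_dpow n : opI K (dpow K n) = dpow K n.+1.
Proof.
apply/polyP => -[|j]; rewrite [LHS](coef_integ _ _) dpow.unlock !coefZ !coefXn.
  by rewrite !mulr0.
rewrite eqSS; case: eqP => [->|_]; last by rewrite !mulr0 mul0r.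
by rewrite !mulr1 -invfM -natrM mulnC -factS.
Qed.

Lemma opX_dpow n : opX K (dpow K n) = n.+1%:R *: dpow K n.+1.
Proof.
rewrite /opX /= /mulX dpow.unlock scalerA -scalerAr -exprS factS natrM invfM.
by rewrite mulrA mulfV ?mul1r ?natf_neq0S.
Qed.

Lemma opH_dpow n : opH K (dpow K n) = n.+1%:R *: dpow K n.
Proof. by rewrite /opH EndoME opX_dpow linearZ /= opD_dpow. Qed.

Lemma opIX_dpow i n : (opI K ^+ i) (dpow K n) = dpow K (i + n).
Proof. by elim: i => [|i IH]; rewrite ?expr0 // exprS EndoME IH opI_dpow. Qed.

Lemma opDX_dpow j n :
  (opD K ^+ j) (dpow K n) = if (j <= n)%N then dpow K (n - j) else 0.
Proof.
elim: j => [|j IH]; first by rewrite subn0.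
rewrite exprS EndoME IH; case: ltngtP => [jn|nj|->].
- by rewrite -(subnSK jn) opD_dpow.
- by rewrite linear0.
- by rewrite subnn opD_dpow0.
Qed.

Lemma atH_dpow q n : atH q (dpow K n) = q.[n.+1%:R] *: dpow K n.
Proof.
elim/poly_ind: q => [|q c IH]; first by rewrite /atH rmorph0 horner0 scale0r.
have -> : atH (q * 'X + c%:P) = atH q * opH K + c *: 1.
  by rewrite /atH rmorphD rmorphM /= horner_algX horner_algC.
rewrite EndoDE EndoME EndoZE Endo1E opH_dpow linearZ IH hornerMXaddC.
by rewrite [LHS]/= scalerA scalerDl mulrC.
Qed.

Lemma e_dpow i j n : e K i j (dpow K n) = (n == j)%:R *: dpow K i.
Proof.
rewrite /e EndoBE !EndoME !opDX_dpow; case: ltngtP => [jn|nj|->].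
- by rewrite !opIX_dpow addSnnS subnSK // subrr scale0r.
- by rewrite 2!linear0 subr0 scale0r.
- by rewrite opIX_dpow linear0 subr0 subnn addn0 scale1r.
Qed.

Lemma entry_e i j r n : entry (e K i j) r n = ((r == i) && (n == j))%:R.
Proof. by rewrite /entry e_dpow linearZ /= dcoord_dpow -mulnb natrM mulrC. Qed.

(** Each [e i j] is a matrix unit in this basis. *)
Lemma entry_Fsum lam i n : entry (Fsum lam) i n = lam (i, n).
Proof.
rewrite /Fsum entry_sum.
rewrite (eq_bigr (fun jl => if jl == (i, n) then lam (i, n) else 0)); last first.
  move=> [r s] _; rewrite entryZ entry_e xpair_eqE /= (eq_sym r) (eq_sym s).
  by case: andP => [[/eqP -> /eqP ->]|_]; rewrite ?mulr1 ?mulr0.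
rewrite -big_mkcond /= big_const_seq.
have -> : count (fun jl => jl == (i, n)) (finsupp lam) = ((i, n) \in finsupp lam).
  exact/count_uniq_mem/fset_uniq.
rewrite mem_finsupp; by case: eqP => [->|_] //=; rewrite addr0.
Qed.

(** The diagonal of index k holds the values of a_k whichever side of the main
    diagonal it lies on, because [atH] stands to the right of the powers of
    [opI] and to the left of the powers of [opD]: it always sees the smaller of
    the two indices. *)
Lemma entry_cf_term k q i n :
  entry (cf_term k q) i n =
  if k == i%:Z - n%:Z then q.[(minn i n).+1%:R] else 0.
Proof.
rewrite /entry /cf_term; case: k => j; rewrite EndoME.
- rewrite atH_dpow linearZ opIX_dpow dcoordZ dcoord_dpow.
  case: eqP => [->|ij].
    have -> : Posz j == (j + n)%:Z - n%:Z by lia.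
    by rewrite mulr1; congr _.[_%:R]; lia.
  rewrite mulr0; case: eqP => // jin; lia.
- rewrite opDX_dpow; case: (leqP j.+1 n) => [jn|nj].
    rewrite atH_dpow dcoordZ dcoord_dpow.
    case: eqP => [->|ij].
      have -> : Negz j == (n - j.+1)%N%:Z - n%:Z by lia.
      by rewrite mulr1; congr _.[_%:R]; lia.
    rewrite mulr0; case: eqP => // jin; lia.
  rewrite !linear0; case: eqP => // jin; lia.
Qed.

Lemma entry_cf_sum (c : {fsfun int -> {poly K} with 0}) (P : pred int) i n :
  entry (\sum_(k <- finsupp c | P k) cf_term k (c k)) i n =
  if P (i%:Z - n%:Z) then (c (i%:Z - n%:Z)).[(minn i n).+1%:R] else 0.
Proof.
rewrite entry_sum; set k0 := i%:Z - n%:Z; set v := (c k0).[_].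
rewrite (eq_bigr (fun k => if k == k0 then v else 0)); last first.
  by move=> k _; rewrite entry_cf_term -/k0; case: eqP => [->|].
rewrite -big_mkcondr /= big_const_seq.
have [Pk0|nPk0] := boolP (P k0); last first.
  rewrite (@eq_count _ _ pred0) ?count_pred0 // => k /=.
  by case: eqP => [->|_]; rewrite ?andbF // (negPf nPk0).
rewrite (@eq_count _ _ (pred1 k0)); last first.
  by move=> k /=; case: eqP => [->|_]; rewrite ?andbF ?Pk0.
rewrite count_uniq_mem ?fset_uniq // mem_finsupp /v.
by case: eqP => [->|_] /=; rewrite ?horner0 ?addr0.
Qed.

Lemma entry_cf_eval cl i n :
  entry (cf_eval cl) i n =
  (cl.1 (i%:Z - n%:Z)).[(minn i n).+1%:R] + cl.2 (i, n).
Proof. by rewrite entryD entry_Fsum entry_cf_sum. Qed.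

(** In characteristic zero the naturals are pairwise distinct in [K], so a
    nonzero polynomial has only finitely many natural roots. *)
Lemma poly_nonroot q : q != 0 ->
  exists N, forall n, (N <= n)%N -> q.[n%:R] != 0.
Proof.
have [m] := ubnP (size q); elim: m q => // m IH q; rewrite ltnS => qm q0.
case: (EM (exists n, root q n%:R)) => [[n0 /factor_theorem[r qE]]|noroot].
  have r0 : r != 0 by apply: contraNneq q0 => r0; rewrite qE r0 mul0r.
  have [|N HN] := IH r _ r0.
    by move: qm; rewrite qE size_Mmonic ?monicXsubC // size_XsubC addn2.
  exists (maxn N n0.+1) => n; rewrite geq_max => /andP[Nn n0n].
  rewrite qE hornerM mulf_neq0 ?HN // hornerXsubC subr_eq0.
  by apply/eqP => /natf_inj E; rewrite E ltnn in n0n.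
by exists 0%N => n _; apply/negP => rn; apply: noroot; exists n.
Qed.

Lemma fsfun_nat2_bound (lam : {fsfun nat * nat -> K with 0}) :
  exists N, forall i n, (N <= i)%N || (N <= n)%N -> lam (i, n) = 0.
Proof.
exists (\sum_(x <- finsupp lam) (x.1 + x.2).+1)%N => i n; apply: contraTeq.
rewrite -mem_finsupp => inl; rewrite (big_rem _ inl) /=; lia.
Qed.

(** The columns of an operator are finite anyway, so it has finitely many
    nonzero entries as soon as almost all its columns vanish. *)
Lemma F_dpowP f : F K f <-> exists N, forall n, (N <= n)%N -> f (dpow K n) = 0.
Proof.
split=> [[lam _ <-]|[N fN]].
  have [N HN] := fsfun_nat2_bound lam; exists N => n Nn; apply: dcoordP => i.
  by rewrite -/(entry _ i n) entry_Fsum linear0 HN // Nn orbT.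
pose M := (\sum_(n < N) size (f (dpow K n)))%N.
pose S := [fset x in allpairs pair (iota 0 M) (iota 0 N)]%fset.
exists [fsfun x in S => entry f x.1 x.2 | 0] => //.
apply: Endo_entryP => i n; rewrite entry_Fsum fsfun_fun.
case: ifPn => //; rewrite in_fset /= => inS.
have [Nn|nN] := leqP N n; first by rewrite /entry fN // linear0.
have [iM|Mi] := ltnP i M.
  by move: inS; rewrite allpairs_f // mem_iota.
apply/esym/(size_dcoordP _ _ (leqnn _)); apply: leq_trans Mi.
by rewrite /M (bigD1 (Ordinal nN)) //= leq_addr.
Qed.

End Coordinates.

(** * Existence of the canonical form *)
Section CanonicalForm.
Variable K : fieldType.
Hypothesis charK : [pchar K] =i pred0.
Implicit Types (f g : Endo K) (p q : {poly K}) (w : nat -> {poly K}).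

(** For n large, w n is the sum over t of P_t(n) y_{n+t}, with polynomials P_t
    that do not depend on n.  The P_t are packed as the coefficients of one
    polynomial, so that sums and scalings of sequences are those of [P]. *)
Definition eventually_banded w := exists (N : nat) (P : {poly {poly K}}),
  forall n i, (N <= n)%N ->
    dcoord i (w n) = if (n <= i)%N then (P`_(i - n)).[n%:R] else 0.

Lemma banded_ext N w w' : (forall n, (N <= n)%N -> w n = w' n) ->
  eventually_banded w -> eventually_banded w'.
Proof.
move=> ww' [M [P HP]]; exists (maxn N M), P => n i.
by rewrite geq_max => /andP[Nn Mn]; rewrite -ww' // HP.
Qed.

Lemma banded_dpow : eventually_banded (dpow K).
Proof.
exists 0%N, 1 => n i _; rewrite (dcoord_dpow charK) coefC.
case: (ltngtP n i) => [ni|//|->]; first by rewrite subn_eq0 leqNgt ni horner0.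
by rewrite subnn hornerC.
Qed.

Lemma banded0 : eventually_banded (fun=> 0).
Proof. by exists 0%N, 0 => n i _; rewrite linear0 coef0 horner0 if_same. Qed.

Lemma bandedD w w' : eventually_banded w -> eventually_banded w' ->
  eventually_banded (fun n => w n + w' n).
Proof.
move=> [N [P HP]] [M [Q HQ]]; exists (maxn N M), (P + Q) => n i.
rewrite geq_max => /andP[Nn Mn]; rewrite linearD /= HP // HQ // coefD hornerD.
by case: ifP; rewrite ?addr0.
Qed.

Lemma banded_scale q w : eventually_banded w ->
  eventually_banded (fun n => q.[n%:R] *: w n).
Proof.
move=> [N [P HP]]; exists N, (q%:P * P) => n i Nn.
by rewrite dcoordZ HP // coefCM hornerM; case: ifP; rewrite ?mulr0.
Qed.

(** A shift by one replaces P_t(n) by P_t(n + 1) and y_{n+t} by y_{n+1+t}. *)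
Lemma banded_shift k w : eventually_banded w ->
  eventually_banded (fun n => w (n + k)%N).
Proof.
elim: k w => [|k IH] w Hw.
  by apply: (@banded_ext 0 _ _ _ Hw) => n _; rewrite addn0.
suff : eventually_banded (fun n => w n.+1).
  by move/IH; apply: (@banded_ext 0) => n _; rewrite addnS.
case: Hw => N [P HP]; exists N.
exists ('X * map_poly (fun q : {poly K} => q \Po ('X + 1)) P) => n i Nn.
rewrite HP ?leqW // coefXM; case: (ltngtP n i) => [ni|ltin|->].
  rewrite subn_eq0 leqNgt ni /=.
  rewrite (coef_map_id0 _ _ (comp_poly0 _)) horner_comp hornerD hornerX hornerC.
  by rewrite subnS -natr1.
- by [].
- by rewrite subnn eqxx horner0.
Qed.

Lemma banded_sum I (r : seq I) (G : I -> nat -> {poly K}) :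
  (forall i, eventually_banded (G i)) ->
  eventually_banded (fun n => \sum_(i <- r) G i n).
Proof.
move=> HG; elim: r => [|i r IH].
  by apply: (@banded_ext 0 _ _ _ banded0) => n _; rewrite big_nil.
by apply: (@banded_ext 0 _ _ _ (bandedD (HG i) IH)) => n _; rewrite big_cons.
Qed.

Lemma banded_expansion w : eventually_banded w -> exists N (P : {poly {poly K}}),
  forall n, (N <= n)%N ->
    w n = \sum_(t < size P) (P`_t).[n%:R] *: dpow K (n + t).
Proof.
move=> [N [P HP]]; exists N, P => n Nn; apply: (dcoordP charK) => i.
rewrite HP // linear_sum /=.
rewrite (eq_bigr (fun t : 'I_(size P) =>
  if i == (n + t)%N then (P`_(i - n)).[n%:R] else 0)); last first.
  move=> t _; rewrite dcoordZ dcoord_dpow //.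
  by case: eqP => [->|_]; rewrite ?mulr0 // mulr1 addKn.
case: leqP => [ni|ltin]; last first.
  by rewrite big1 // => t _; rewrite ltn_eqF // (leq_trans ltin) ?leq_addr.
have [inP|Pin] := ltnP (i - n) (size P).
  rewrite (bigD1 (Ordinal inP)) //= subnKC // eqxx big1 ?addr0 // => t.
  by rewrite -val_eqE /= => /eqP tn; case: eqP => // E; case: tn; rewrite E addKn.
rewrite nth_default // horner0 big1 // => t _.
by case: eqP => //; have := ltn_ord t; lia.
Qed.

(** The delay [B] makes all band offsets nonnegative, which avoids truncated
    subtractions in [eventually_banded]. *)
Definition banded_op f := exists B, eventually_banded (fun n => f (dpow K (n + B))).

Lemma banded_opW B C f : eventually_banded (fun n => f (dpow K (n + B))) ->
  eventually_banded (fun n => f (dpow K (n + (C + B)))).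
Proof.
move/(banded_shift C); apply: (@banded_ext 0) => n _.
by rewrite addnA.
Qed.

Lemma banded_op1 : banded_op 1.
Proof. by exists 0%N; apply: banded_shift; apply: banded_dpow. Qed.

Lemma banded_opZD k f g : banded_op f -> banded_op g -> banded_op (k *: f + g).
Proof.
move=> [B HB] [C HC]; exists (C + B)%N.
have Hf := banded_scale k%:P (banded_opW C HB).
have := banded_opW B HC; rewrite addnC => Hg.
by apply: (@banded_ext 0 _ _ _ (bandedD Hf Hg)) => n _; rewrite hornerC.
Qed.

(** Applying f to the sum of Q_t(n + B) y_{n+t+B} gives the sum of the shifted
    sequences f y_{n+t+B}, scaled by polynomials in n. *)
Lemma banded_opM f g : banded_op f -> banded_op g -> banded_op (f * g).
Proof.
move=> [B HB] [C HC]; exists (B + C)%N.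
have [N [P HP]] := banded_expansion HC.
apply: (@banded_ext N (fun n => \sum_(t < size P)
  (P`_t \Po ('X + B%:R%:P)).[n%:R] *: f (dpow K (n + t + B)))).
  move=> n Nn; rewrite EndoME addnA HP ?(leq_trans Nn) ?leq_addr // linear_sum.
  apply: eq_bigr => t _; rewrite linearZ horner_comp hornerD hornerX hornerC.
  by rewrite natrD addnAC.
apply: banded_sum => t; apply: banded_scale.
exact: (@banded_shift t (fun n => f (dpow K (n + B)))).
Qed.

Lemma banded_opX : banded_op (opX K).
Proof.
exists 0%N; apply: (@banded_ext 0 (fun n => ('X + 1).[n%:R] *: dpow K (n + 1))).
  by move=> n _; rewrite addn0 opX_dpow // !hornerE natr1 addn1.
by apply/banded_scale/banded_shift; apply: banded_dpow.
Qed.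

Lemma banded_opI : banded_op (opI K).
Proof.
exists 0%N; apply: (@banded_ext 0 (fun n => dpow K (n + 1))).
  by move=> n _; rewrite addn0 opI_dpow // addn1.
by apply/banded_shift; apply: banded_dpow.
Qed.

Lemma banded_opD : banded_op (opD K).
Proof.
exists 1%N; apply: (@banded_ext 0 (dpow K)); last exact: banded_dpow.
by move=> n _; rewrite addn1 opD_dpow.
Qed.

Lemma I1_subalg : GRing.subalg_closed [in I1 K].
Proof.
split=> [|k f g|f g]; rewrite !in_setE.
- by move=> S [[S1 _ _] _]; have := S1; rewrite in_setE.
- move=> Hf Hg S HS; case: (HS) => [[_ SZ _] _].
  have := SZ k f g; rewrite !in_setE; apply; [exact: Hf|exact: Hg].
- move=> Hf Hg S HS; case: (HS) => [[_ _ SM] _].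
  have := SM f g; rewrite !in_setE; apply; [exact: Hf|exact: Hg].
Qed.

Lemma I1_banded f : I1 K f -> banded_op f.
Proof.
apply; split; last first.
  by move=> g [[->|->]|->];
    [exact: banded_opX|exact: banded_opD|exact: banded_opI].
split=> [|k g h|g h]; rewrite !in_setE;
  [exact: banded_op1|exact: banded_opZD|exact: banded_opM].
Qed.

(** The polynomials of the band determine a_k for every k; subtracting them
    leaves an operator that kills almost all divided powers, hence lies in
    [F]. *)
Lemma banded_cf f : banded_op f -> exists cl, cf_eval cl = f.
Proof.
move=> [B [N [P HP]]].
pose S := [fset k in map (fun t : nat => t%:Z - B%:Z) (iota 0 (size P))]%fset.
(* The diagonal k = t - B reads P_t(n) at column n + B and row n + t; the
   smaller of the two plus one is n + B + 1 if k >= 0, and n + t + 1 if not. *)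
pose co (k : int) := let t := `|(k + B%:Z)%R|%N in
  if 0 <= k then P`_t \Po ('X - B.+1%:R%:P) else P`_t \Po ('X - t.+1%:R%:P).
pose c := [fsfun k in S => co k | 0] : {fsfun int -> {poly K} with 0}.
have cE k : c k = if - B%:Z <= k then co k else 0.
  rewrite fsfun_fun in_fset; case: mapP => [[t _ ->]|nk].
    by have -> : - B%:Z <= t%:Z - B%:Z by lia.
  case: leP => // Bk; rewrite /co nth_default ?comp_poly0 ?if_same //.
  rewrite leqNgt; apply/negP => kP; apply: nk; exists `|(k + B%:Z)%R|%N; last lia.
  by rewrite mem_iota.
have : F K (f - cf_eval (c, [fsfun])).
  apply/(F_dpowP charK); exists (N + B)%N => n NBn.
  apply: (dcoordP charK) => i; rewrite linear0 EndoBE dcoordB.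
  rewrite [X in _ - X](entry_cf_eval charK _ i n) fsfun0E addr0 [(_, _).1]/= cE.
  have -> : n = (n - B + B)%N by lia.
  set m := (n - B)%N; have Nm : (N <= m)%N by lia.
  rewrite HP //; apply/eqP; rewrite subr_eq0; apply/eqP.
  have -> : (- B%:Z <= i%:Z - (m + B)%:Z) = (m <= i)%N by lia.
  case: leqP => [mi|]; last by rewrite horner0.
  rewrite /co; have -> : `|((i%:Z - (m + B)%:Z) + B%:Z)%R|%N = (i - m)%N by lia.
  have [h|h] := leP 0 (i%:Z - (m + B)%:Z); rewrite horner_comp !hornerE.
    have -> : minn i (m + B) = (m + B)%N by lia.
    by congr _.[_]; rewrite -addnS natrD addrK.
  have -> : minn i (m + B) = i by lia.
  have -> : i.+1%:R = m%:R + (i - m).+1%:R :> K by rewrite -natrD; congr _%:R; lia.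
  by rewrite addrK.
move=> [lam _ lamE]; exists (c, lam).
rewrite /cf_eval /= lamE /cf_eval [Fsum _](_ : _ = 0) ?addr0; last first.
  by apply: (Endo_entryP charK) => i n; rewrite entry_Fsum // fsfun0E /entry linear0.
by rewrite addrC subrK.
Qed.

Lemma canformK f : I1 K f -> cf_eval (canform f) = f.
Proof. by move=> /I1_banded/banded_cf ex; apply: (xgetPex _ ex). Qed.

End CanonicalForm.

(** * Operators that eventually shift degrees *)
Section Shifts.
Variable K : fieldType.
Implicit Types (f g : Endo K) (p q : {poly K}).

Definition size_bounded f N M := forall p, (size p <= N)%N -> (size (f p) <= M)%N.

(** Such an operator is controlled by its finite corner
    K[x]_{<N} -> K[x]_{<M}: beyond it, f changes degrees by M - N and is
    triangular.  Its index is N - M. *)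
Definition shifts f N M := size_bounded f N M /\
  forall p, (N < size p)%N -> (size (f p) + N = size p + M)%N.

(** Row vectors of length [N] stand for polynomials of degree < N, and the
    matrix acts on them from the right. *)
Definition truncmx f N M : 'M[K]_(N, M) := lin1_mx (poly_rV \o f \o rVpoly).

Lemma truncmxE f N M (u : 'rV_N) : u *m truncmx f N M = poly_rV (f (rVpoly u)).
Proof. by rewrite mul_rV_lin1. Qed.

Lemma size_rVpoly n (u : 'rV[K]_n) : (size (rVpoly u) <= n)%N.
Proof. exact: size_poly. Qed.

Lemma truncmxK f N M (u : 'rV_N) : size_bounded f N M ->
  rVpoly (u *m truncmx f N M) = f (rVpoly u).
Proof. by move=> fNM; rewrite truncmxE poly_rV_K // fNM // size_rVpoly. Qed.

Lemma truncmx_free f N M :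
  size_bounded f N M -> injective f -> row_free (truncmx f N M).
Proof.
move=> fNM finj; apply: inj_row_free => u u0.
apply: (can_inj rVpolyK); apply: finj.
by rewrite -(truncmxK _ fNM) u0 !linear0.
Qed.

Lemma size_bounded_inj_leq f N M : size_bounded f N M -> injective f -> (N <= M)%N.
Proof.
by move=> fNM finj; rewrite -(eqP (truncmx_free fNM finj)) rank_leq_col.
Qed.

Lemma size_bounded_surj_leq f N M : size_bounded f N M ->
  (forall q, (size q <= M)%N -> exists2 p : {poly K}, (size p <= N)%N & f p = q) ->
  (M <= N)%N.
Proof.
move=> fNM fsurj; suff /eqP <- : row_full (truncmx f N M) by exact: rank_leq_row.
rewrite -sub1mx; apply/row_subP => i; set v := row i _.
have [p pN fp] := fsurj _ (size_rVpoly v).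
by apply/submxP; exists (poly_rV p); rewrite truncmxE poly_rV_K // fp rVpolyK.
Qed.

Lemma size_bounded_inj_onto f N : size_bounded f N N -> injective f ->
  forall q, (size q <= N)%N -> exists2 p : {poly K}, (size p <= N)%N & f p = q.
Proof.
move=> fN finj q qN; have := truncmx_free fN finj.
rewrite row_free_unit -row_full_unit => /(submx_full (poly_rV q))/submxP[u uE].
exists (rVpoly u); first exact: size_rVpoly.
by rewrite -(truncmxK _ fN) -uE poly_rV_K.
Qed.

Section OneShift.
Variables (f : Endo K) (N M : nat).
Hypothesis fNM : shifts f N M.

Lemma shifts_preim p : (size (f p) <= M)%N -> (size p <= N)%N.
Proof.
rewrite [(size p <= N)%N]leqNgt => fpM; apply/negP => Np.
by have := fNM.2 _ Np; lia.
Qed.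

Lemma shifts_ker p : f p = 0 -> (size p <= N)%N.
Proof. by move=> fp0; apply: shifts_preim; rewrite fp0 size_poly0. Qed.

(** Division with remainder by the range of f: a leading term of degree >= M
    is that of the image of a monomial. *)
Lemma shifts_reduce q : exists p r, q = f p + r /\ (size r <= M)%N.
Proof.
have [n] := ubnP (size q); elim: n q => // n IH q; rewrite ltnS => qn.
have [qM|Mq] := leqP (size q) M.
  by exists 0, q; rewrite linear0 add0r.
pose g := f 'X^((size q - M + N).-1).
have gq : size g = size q.
  by have := fNM.2 'X^((size q - M + N).-1); rewrite size_polyXn -/g; lia.
have g0 : lead_coef g != 0 by rewrite lead_coef_eq0 -size_poly_gt0 gq; lia.
pose k := lead_coef q / lead_coef g.
have [|p [r [qE rM]]] := IH (q - k *: g).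
  apply: leq_trans qn; have q0 : (0 < size q)%N by lia.
  rewrite -[X in (_ < X)%N](prednK q0) ltnS; apply/leq_sizeP => j.
  rewrite leq_eqVlt coefB coefZ => /predU1P[<-|]; last first.
    by rewrite prednK // => qj; rewrite !nth_default ?gq // mulr0 subr0.
  by rewrite -{2}gq /k !lead_coefE -!lead_coefE divfK ?subrr.
exists (p + k *: 'X^((size q - M + N).-1)), r; split=> //.
by rewrite linearD linearZ -/g addrAC -qE subrK.
Qed.

Lemma shifts_surj :
  (forall q, (size q <= M)%N -> exists p, f p = q) -> forall q, exists p, f p = q.
Proof.
move=> fsurj q; have [p [r [-> /fsurj[s <-]]]] := shifts_reduce q.
by exists (p + s); rewrite linearD.
Qed.

Lemma shifts_inj :
  (forall p, (size p <= N)%N -> f p = 0 -> p = 0) -> injective f.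
Proof.
move=> finj; apply: raddf_inj => p fp0.
exact: finj (shifts_ker fp0) fp0.
Qed.

(** A bijective f restricts to a bijection of the finite corner. *)
Lemma shifts_bij_eq : bijective f -> N = M.
Proof.
move=> fbij; apply/eqP; rewrite eqn_leq.
rewrite (size_bounded_inj_leq fNM.1 (bij_inj fbij)).
rewrite (size_bounded_surj_leq fNM.1) // => q qM.
have [g _ gK] := fbij; exists (g q); last exact: gK.
by apply: shifts_preim; rewrite gK.
Qed.

Lemma sum_row_rVpoly r n (B : 'M[K]_(r, n)) (c : 'I_r -> K) :
  \sum_(i < r) c i *: rVpoly (row i B) = rVpoly ((\row_i c i) *m B).
Proof.
rewrite mulmx_sum_row linear_sum; apply: eq_bigr => i _.
by rewrite linearZ mxE.
Qed.

(** The kernel lies in K[x]_{<N}, so it is that of the corner matrix. *)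
Lemma shifts_dim_ker : exists n, is_dim_quot [set p | f p = 0] [set 0] n.
Proof.
set A := truncmx f N M; set B := row_base (kermx A).
have BA : B *m A = 0 by apply/sub_kermxP; rewrite eq_row_base.
exists (\rank (kermx A)), (fun i => rVpoly (row i B)); split=> [i|v /= fv0].
  by rewrite /= -(truncmxK _ fNM.1) -row_mul BA row0 linear0.
have vN := shifts_ker fv0.
have : (poly_rV v <= B)%MS.
  by rewrite eq_row_base; apply/sub_kermxP; rewrite truncmxE poly_rV_K // fv0 linear0.
move=> /submxP[D vE]; exists [ffun i => D 0 i]; split=> /=.
  under eq_bigr do rewrite ffunE.
  rewrite sum_row_rVpoly (_ : \row_i _ = D); last by apply/rowP => i; rewrite mxE.
  by rewrite -vE poly_rV_K // subrr.
move=> c; rewrite sum_row_rVpoly => /eqP; rewrite subr_eq0 => /eqP vE'.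
have /(row_free_inj (row_base_free _)) -> : D *m B = (\row_i c i) *m B.
  by rewrite -vE vE' rVpolyK.
by apply/ffunP => i; rewrite ffunE mxE.
Qed.

(** Any complement of the row space of the corner matrix is a complement of
    the range of f: [shifts_reduce] brings every polynomial into K[x]_{<M},
    where the range of f coincides with that of the corner. *)
Lemma shifts_dim_coker : exists n, is_dim_quot [set: {poly K}] (range f) n.
Proof.
set A := truncmx f N M; set B := row_base (A^C)%MS.
exists (\rank (A^C)%MS), (fun i => rVpoly (row i B)); split=> [//|v _].
have [p [r [-> rM]]] := shifts_reduce v.
have : (poly_rV r <= A + B)%MS.
  by rewrite (adds_eqmx (eqmx_refl _) (eq_row_base _)) submx_full ?addsmx_compl_full.
move=> /sub_addsmxP[[D1 D2] /= rE]; exists [ffun i => D2 0 i]; split.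
  under eq_bigr do rewrite ffunE.
  rewrite sum_row_rVpoly (_ : \row_i _ = D2); last by apply/rowP => i; rewrite mxE.
  exists (p + rVpoly D1) => //.
  by rewrite linearD -(truncmxK _ fNM.1) -(poly_rV_K rM) rE linearD addrA addrK.
move=> c [s _]; rewrite sum_row_rVpoly => sE.
pose u := \row_i c i - D2.
have uE : f (p + rVpoly D1 - s) = rVpoly (u *m B).
  rewrite linearB sE linearD -(truncmxK _ fNM.1) mulmxBl linearB.
  by rewrite -(poly_rV_K rM) rE linearD /=; ring.
have sN : (size (p + rVpoly D1 - s)%R <= N)%N.
  by apply: shifts_preim; rewrite uE size_rVpoly.
have : (u *m B <= A :&: A^C)%MS.
  have uBC : (u *m B <= A^C)%MS 
    by apply: submx_trans (submxMl _ _) _; rewrite eq_row_base.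
  rewrite sub_capmx uBC andbT.
  by apply/submxP; exists (poly_rV (p + rVpoly D1 - s));
    rewrite truncmxE poly_rV_K // uE rVpolyK.
rewrite capmx_compl submx0 => /eqP uB0.
have /(row_free_inj (row_base_free _)) /eqP : u *m B = 0 *m B by rewrite uB0 mul0mx.
rewrite subr_eq0 => /eqP cE; apply/ffunP => i.
by rewrite ffunE -cE mxE.
Qed.

(** With finite dimensional kernel and cokernel, index zero means that one is
    zero exactly when the other is.  Uniqueness of the coordinates on a basis
    shows that the dimension of a zero quotient is 0. *)
Lemma ind0_inj_surj : ind f = 0 -> injective f <-> (forall q, exists p, f p = q).
Proof.
rewrite /ind => ind0.
have [b [bker kerP]] : is_dim_quot [set p | f p = 0] [set 0] (dim_ker f).
  exact: (xgetPex _ shifts_dim_ker).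
have [c [_ cokerP]] : is_dim_quot [set: {poly K}] (range f) (dim_coker f).
  exact: (xgetPex _ shifts_dim_coker).
have eqd : dim_ker f = dim_coker f by lia.
split=> [finj q|fsurj].
  have b0 i : b i = 0 by apply: finj; rewrite linear0; exact: bker.
  have n0 : dim_ker f = 0%N.
    case: (dim_ker f) b {bker} b0 kerP => // n b b0 /(_ 0) [|x [_ xP]].
      by rewrite /= linear0.
    have Z (y : {ffun 'I_n.+1 -> K}) : [set 0] (0 - \sum_(i < n.+1) y i *: b i).
      by rewrite /= big1 ?subr0 // => i _; rewrite b0 scaler0.
    have := xP _ (Z [ffun=> 1]); rewrite (xP _ (Z [ffun=> 0])).
    by move/ffunP/(_ ord0)/eqP; rewrite !ffunE eq_sym oner_eq0.
  rewrite n0 in eqd; case: _ / eqd c cokerP => c /(_ q I) [x [[p _ pE] _]].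
  by exists p; rewrite pE big_ord0 subr0.
have m0 : dim_coker f = 0%N.
  case: (dim_coker f) c cokerP => // n c /(_ 0 I) [x [_ xP]].
  have Z (y : {ffun 'I_n.+1 -> K}) : range f (0 - \sum_(i < n.+1) y i *: c i).
    by have [p <-] := fsurj (0 - \sum_(i < n.+1) y i *: c i); exists p.
  have := xP _ (Z [ffun=> 1]); rewrite (xP _ (Z [ffun=> 0])).
  by move/ffunP/(_ ord0)/eqP; rewrite !ffunE eq_sym oner_eq0.
rewrite m0 in eqd; apply: raddf_inj => p fp0.
move: b bker kerP; rewrite eqd => b _ /(_ p fp0) [x [/=]].
by rewrite big_ord0 subr0.
Qed.

End OneShift.
End Shifts.

(** * Top and bottom coefficients of a canonical form *)
Lemma seq_int_max (s : seq int) : s != [::] ->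
  exists2 m, m \in s & {in s, forall k, k <= m}.
Proof.
elim: s => // x [|y s] IH _.
  by exists x; rewrite ?mem_head // => k; rewrite inE => /eqP ->.
have [//|m ms mP] := IH; have [xm|mx] := leP x m.
  by exists m; [rewrite inE ms orbT|move=> k; rewrite inE => /predU1P[->|/mP]].
exists x; first exact: mem_head.
by move=> k; rewrite inE => /predU1P[->//|/mP km]; apply: le_trans km (ltW mx).
Qed.

Section Top.
Variable K : fieldType.
Hypothesis charK : [pchar K] =i pred0.
Implicit Types (f g a u v : Endo K) (p q : {poly K}).

Lemma bij_Aut f : injective f -> (forall q, exists p, f p = q) -> Aut K f.
Proof.
move=> finj /choice[g fg]; have gf : cancel f g by move=> p; apply: finj.
pose gl : {linear {poly K} -> {poly K}} :=
  HB.pack g (GRing.isLinear.Build K {poly K} {poly K} _ g (can2_linear gf fg)).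
by exists gl.
Qed.

Lemma Aut_bij f : Aut K f -> bijective f.
Proof. by move=> [g [fg gf]]; exists g. Qed.

Lemma entries_shifts f N M :
  (forall i n, (M <= i)%N -> (n + M < i + N)%N -> entry f i n = 0) ->
  (forall n, entry f (n + M) (n + N) != 0) -> shifts f N M.
Proof.
move=> f0 fd; split=> p pN.
  apply/(size_dcoordP charK) => i Mi; rewrite (dcoord_apply charK _ _ pN).
  by rewrite big1 // => n _; rewrite f0 ?mulr0 //; have := ltn_ord n; lia.
have [s sE] : exists s, size p = s.+1 by exists (size p).-1; lia.
have ps : (size p <= s.+1)%N by rewrite sE.
suff : size (f p) = (s - N + M).+1 by lia.
apply/eqP; rewrite eqn_leq; apply/andP; split.
  apply/(size_dcoordP charK) => i Mi; rewrite (dcoord_apply charK _ _ ps).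
  by rewrite big1 // => n _; rewrite f0 ?mulr0 //; have := ltn_ord n; lia.
rewrite ltnNge; apply/negP => /(size_dcoordP charK)/(_ _ (leqnn _)).
rewrite (dcoord_apply charK _ _ ps) big_ord_recr big1 => [/= /eqP|n _].
  have {3}-> : s = (s - N + N)%N by lia.
  rewrite add0r mulf_eq0 (negPf (fd _)) orbF dcoord_eq0 //.
  have -> : s = (size p).-1 by lia.
  by rewrite -lead_coefE lead_coef_eq0 -size_poly_eq0; lia.
by rewrite f0 ?mulr0 //= ; have := ltn_ord n; lia.
Qed.

Lemma entries_size_bounded f N M :
  (forall i n, (M <= i)%N -> (n < N)%N -> entry f i n = 0) -> size_bounded f N M.
Proof.
move=> f0 p pN; apply/(size_dcoordP charK) => i Mi.
by rewrite (dcoord_apply charK _ _ pN) big1 // => n _; rewrite f0 ?mulr0.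
Qed.

Lemma cf_top cl : ~ F K (cf_eval cl) ->
  exists2 m : int, cl.1 m != 0 & forall k : int, m < k -> cl.1 k = 0.
Proof.
move=> nF; have [s0|/seq_int_max[m ms mP]] := eqVneq (finsupp cl.1 : seq int) [::].
  by case: nF; exists cl.2; rewrite // /cf_eval s0 big_nil add0r.
exists m => [|k mk]; first by rewrite -mem_finsupp.
by apply/eqP; apply: contraTT mk; rewrite -mem_finsupp -leNgt => /mP.
Qed.

Lemma cf_bottom cl : ~ F K (cf_eval cl) ->
  exists2 m : int, cl.1 m != 0 & forall k : int, k < m -> cl.1 k = 0.
Proof.
move=> nF; have [s0|s0] := eqVneq (finsupp cl.1 : seq int) [::].
  by case: nF; exists cl.2; rewrite // /cf_eval s0 big_nil add0r.
have [|m /mapP[k ks ->] mP] := @seq_int_max (map -%R (finsupp cl.1)).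
  by case: (finsupp cl.1 : seq int) s0.
exists k => [|l lk]; first by rewrite -mem_finsupp.
apply/eqP; apply: contraTT lk; rewrite -mem_finsupp -leNgt => ls.
by rewrite -lerN2; apply: mP; apply: map_f.
Qed.

(** Far from the corner, the entry of highest row in column n is a value of the
    top coefficient, in row n + m; it is nonzero for large n. *)
Lemma cf_shifts (cl : cf K) (m : int) : 
  cl.1 m != 0 -> (forall k, m < k -> cl.1 k = 0) ->
  exists N M, M%:Z = N%:Z + m /\ shifts (cf_eval cl) N M.
Proof.
move=> cm ctop; have [R lam0] := fsfun_nat2_bound cl.2.
have [Q cQ] := poly_nonroot charK cm.
(* beyond the finite part and the roots of the top coefficient, even after a
   shift by m *)
pose N := (R + Q + `|m|)%N; exists N, `|(N%:Z + m)%R|%N; split; first lia.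
apply: entries_shifts => [i n Mi nMi|n]; rewrite entry_cf_eval //.
  rewrite ctop ?horner0 ?add0r; last lia.
  by apply: lam0; lia.
rewrite (lam0 _ _); last by lia.
have -> : (n + `|(N%:Z + m)%R|%N)%N%:Z - (n + N)%N%:Z = m by lia.
by rewrite addr0; apply: cQ; lia.
Qed.

Lemma I1_shifts f : I1 K f -> ~ F K f -> exists N M, shifts f N M.
Proof.
move=> fI; rewrite -{1 2}(canformK charK fI) => /cf_top[m cm /(cf_shifts cm)].
by move=> [N [M [_ fNM]]]; exists N, M.
Qed.

Lemma Aut_not_F f : Aut K f -> ~ F K f.
Proof.
move=> /Aut_bij/bij_inj finj /(F_dpowP charK)[N /(_ N (leqnn N))].
rewrite -(linear0 f) => /finj /(congr1 (dcoord N)).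
by rewrite dcoord_dpow // linear0 eqxx => /eqP; rewrite oner_eq0.
Qed.

(** A bijective operator has top index M - N = 0. *)
Lemma Aut_coefH f : I1 K f -> Aut K f ->
  coefH f 0 != 0 /\ forall k : int, 0 < k -> coefH f k = 0.
Proof.
move=> fI fA; have fE := canformK charK fI.
have [|m cm ctop] := @cf_top (canform f); first by rewrite fE; exact: Aut_not_F.
have [N [M [MN]]] := cf_shifts cm ctop; rewrite fE.
move=> /shifts_bij_eq/(_ (Aut_bij fA)) NM.
have m0 : m = 0 by lia.
by move: cm ctop; rewrite m0.
Qed.

Lemma entry_part_minus f i n : entry (part_minus f) i n =
  if (i < n)%N then (coefH f (i%:Z - n%:Z)).[i.+1%:R] else 0.
Proof.
rewrite /part_minus (entry_cf_sum charK (canform f).1 (fun k => k < 0)).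
have -> : (i%:Z - n%:Z < 0) = (i < n)%N by lia.
by case: leqP => // lin; rewrite (minn_idPl (ltnW lin)).
Qed.

Lemma entry_part_zero f i n :
  entry (part_zero f) i n = (i == n)%:R * (coefH f 0).[n.+1%:R].
Proof. by rewrite /entry /part_zero atH_dpow // dcoordZ dcoord_dpow // mulrC. Qed.

Lemma entry_part_F f i n : entry (part_F f) i n = (canform f).2 (i, n).
Proof. exact: entry_Fsum. Qed.

Lemma Aut_parts f : I1 K f -> Aut K f -> f = part_minus f + part_zero f + part_F f.
Proof.
move=> fI /(Aut_coefH fI)[_ ctop]; apply: (Endo_entryP charK) => i n.
rewrite -{1}(canformK charK fI) entry_cf_eval // !entryD.
rewrite entry_part_minus entry_part_zero entry_part_F; congr (_ + _).
rewrite -/(coefH f _); case: (ltngtP i n) => [lin|ltni|->].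
- by rewrite mul0r addr0.
- by rewrite ctop ?horner0 ?mul0r ?addr0 //; lia.
- by rewrite add0r mul1r subrr.
Qed.

Lemma F_le_Fsum (lam : {fsfun nat * nat -> K with 0}) N :
  F_le N (Fsum lam) <-> forall i n, (N < i)%N || (N < n)%N -> lam (i, n) = 0.
Proof.
have entryM (mu : 'M[K]_N.+1) i n :
    entry (\sum_(i < N.+1) \sum_(j < N.+1) mu i j *: e K i j) i n =
    \sum_(r < N.+1) \sum_(s < N.+1)
      if (r == i :> nat) && (s == n :> nat) then mu r s else 0.
  rewrite entry_sum; apply: eq_bigr => r _; rewrite entry_sum; apply: eq_bigr => s _.
  by rewrite entryZ entry_e // (eq_sym i) (eq_sym n) mulr_natr mulrb.
split=> [[mu _ muE] i n Nin|lam0].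
  rewrite -entry_Fsum // -muE entryM big1 // => r _; rewrite big1 // => s _.
  case: ifP => // /andP[/eqP ri /eqP sn]; have := ltn_ord r; have := ltn_ord s; lia.
exists (\matrix_(i, j) lam (i : nat, j : nat)) => //.
apply: (Endo_entryP charK) => i n; rewrite entryM entry_Fsum //.
have [iN|Ni] := leqP i N; last first.
  rewrite lam0 ?Ni // big1 // => r _; rewrite big1 // => s _.
  by case: ifP => // /andP[/eqP ri _]; have := ltn_ord r; lia.
have [nN|Nn] := leqP n N; last first.
  rewrite lam0 ?Nn ?orbT // big1 // => r _; rewrite big1 // => s _.
  by case: ifP => // /andP[_ /eqP sn]; have := ltn_ord s; lia.
rewrite (bigD1 (inord i)) //= [X in _ + X]big1 => [|r ri]; last first.
  rewrite big1 // => s _; case: eqP => // E; case/eqP: ri.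
  by apply: val_inj; rewrite /= inordK.
rewrite (bigD1 (inord n)) //= big1 => [|s sn]; last first.
  case: eqP => //= _; case: eqP => // E; case/eqP: sn.
  by apply: val_inj; rewrite /= inordK.
by rewrite !inordK // !eqxx !addr0 mxE !inordK.
Qed.

(** [D] is d + 1, a natural number also when d = -1: the finite part of the
    canonical form is supported in the leading D x D corner. *)
Lemma degFP f : exists D : nat, degF f = D%:Z - 1 /\
  forall i n, (D <= i)%N || (D <= n)%N -> (canform f).2 (i, n) = 0.
Proof.
rewrite /degF; case: eqP => [F0|_].
  by exists 0%N; split=> // i n _; rewrite -entry_part_F F0 /entry linear0.
set P := [set n | F_le n (part_F f)].
have exP : exists n, `[< P n >].
  have [N lam0] := fsfun_nat2_bound (canform f).2; exists N; apply/asboolP.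
  by apply/F_le_Fsum => i n Nin; apply: lam0; lia.
have [m /asboolP Pm mmin] := ex_minnP exP.
have : [set n | P n /\ forall m, P m -> (n <= m)%N] (min_nat P).
  by apply: xgetPex; exists m; split=> // k Pk; apply: mmin; apply/asboolP.
move=> [/F_le_Fsum lam0 _]; exists (min_nat P).+1; split=> [|i n Nin]; first lia.
exact: lam0.
Qed.

End Top.

(** * Block decomposition along K[x]_{<=d} + K[x]_{>d} *)
Section BlockCalculus.
Variables (K : fieldType) (d : int).
Implicit Types (f g : Endo K) (p q : {poly K}).

Lemma in_le_size D p : d = D%:Z - 1 -> in_le d p = (size p <= D)%N.
Proof.
move=> dE; apply/in_leP/leq_sizeP => p0 i di; apply: p0; lia.
Qed.

Lemma proj_leK (v : pol_le K d) : proj_le d (val v) = v.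
Proof.
apply: val_inj; apply/polyP => i /=; rewrite coef_trunc_le.
by case: leP => // di; rewrite (in_leP _ _ (valP v)).
Qed.

Lemma proj_gtK (v : pol_gt K d) : proj_gt d (val v) = v.
Proof.
apply: val_inj; apply/polyP => i /=; rewrite coef_trunc_gt.
by case: ltP => // di; rewrite (in_gtP _ _ (valP v)).
Qed.

Lemma proj_gt_le p : in_le d p -> proj_gt d p = 0.
Proof.
move=> /in_leP p0; apply: val_inj; apply/polyP => i /=.
by rewrite coef_trunc_gt coef0; case: ifP => // /p0.
Qed.

Lemma proj_le_gt p : in_gt d p -> proj_le d p = 0.
Proof.
move=> /in_gtP p0; apply: val_inj; apply/polyP => i /=.
by rewrite coef_trunc_le coef0; case: ifP => // /p0.
Qed.

Lemma proj_split p : p = val (proj_le d p) + val (proj_gt d p).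
Proof.
apply/polyP => i; rewrite coefD /= coef_trunc_le coef_trunc_gt.
by case: leP; rewrite ?addr0 ?add0r.
Qed.

Lemma proj_inj p q : proj_le d p = proj_le d q -> proj_gt d p = proj_gt d q -> p = q.
Proof. by move=> El Eg; rewrite (proj_split p) El Eg -proj_split. Qed.

Lemma proj_le_block_map h11 h12 h21 h22 p :
  proj_le d (block_map (d := d) h11 h12 h21 h22 p) =
  h11 (proj_le d p) + h12 (proj_gt d p).
Proof.
rewrite linearD /= (proj_leK (_ + _)) (proj_le_gt (valP (_ + _ : pol_gt K d))).
by rewrite addr0.
Qed.

Lemma proj_gt_block_map h11 h12 h21 h22 p :
  proj_gt d (block_map (d := d) h11 h12 h21 h22 p) =
  h21 (proj_le d p) + h22 (proj_gt d p).
Proof.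
rewrite linearD /= (proj_gtK (_ + _)) (proj_gt_le (valP (_ + _ : pol_le K d))).
by rewrite add0r.
Qed.

Lemma block_map_inverse h11 h12 h22 k11 k22 :
  lin_inverse h11 k11 -> lin_inverse h22 k22 ->
  lin_inverse (block_map h11 h12 \0 h22 : Endo K)
    (block_map (d := d) k11 (\- (k11 \o h12 \o k22)) \0 k22 : Endo K).
Proof.
move=> [fg1 gf1] [fg2 gf2]; split=> p; apply: proj_inj;
  rewrite !(proj_le_block_map, proj_gt_block_map) /= ?add0r ?fg2 ?gf2 //.
  by rewrite linearD /= fg1 addrK.
by rewrite linearB /= gf1 gf1 subrK.
Qed.

Definition le_stable f := forall p, in_le d p -> in_le d (f p).

Lemma restricts_block11 f : le_stable f -> restricts_to f (block11 d f).
Proof.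
move=> fs v; have fv := fs _ (valP v).
exact: (congr1 val (proj_leK (PolLe fv))).
Qed.

Lemma induces_block22 f : le_stable f -> induces f (block22 d f).
Proof.
move=> fs p; rewrite {2}(proj_split p) !linearD /=.
by rewrite (proj_gt_le (fs _ (valP (proj_le d p)))) add0r.
Qed.

Lemma block_map_id f : le_stable f ->
  f = block_map (block11 d f) (block12 d f) \0 (block22 d f).
Proof.
move=> fs; apply: EndoP => p; apply: proj_inj.
  by rewrite proj_le_block_map /= -!linearD -proj_split.
by rewrite proj_gt_block_map -(induces_block22 fs) /= add0r.
Qed.

Lemma block11_inverse f g : lin_inverse f g -> le_stable f -> le_stable g ->
  lin_inverse (block11 d f) (block11 d g).
Proof.
move=> [fg gf] fs gs; split=> v; apply: val_inj.
  by rewrite !restricts_block11.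
by rewrite !restricts_block11.
Qed.

Lemma block22_inverse f g : lin_inverse f g -> le_stable f -> le_stable g ->
  lin_inverse (block22 d f) (block22 d g).
Proof.
move=> [fg gf] fs gs; split=> v; rewrite -[in LHS](proj_gtK v).
  by rewrite (induces_block22 fs) (induces_block22 gs) fg proj_gtK.
by rewrite (induces_block22 gs) (induces_block22 fs) gf proj_gtK.
Qed.

End BlockCalculus.

(** * Diagonal operators *)
Section Diagonal.
Variable K : fieldType.
Hypothesis charK : [pchar K] =i pred0.
Implicit Types (c : nat -> K) (p : {poly K}).

Definition diag_fun c p : {poly K} := \poly_(i < size p) (c i * p`_i).

Lemma coef_diag_fun c p i : (diag_fun c p)`_i = c i * p`_i.
Proof.
by rewrite coef_poly; case: ltnP => // pi; rewrite nth_default // mulr0.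
Qed.

Fact diag_fun_linear c : linear (diag_fun c).
Proof.
move=> k p q; apply/polyP => i; rewrite coefD coefZ !coef_diag_fun coefD coefZ; ring.
Qed.
HB.instance Definition _ c :=
  GRing.isLinear.Build K {poly K} {poly K} _ (diag_fun c) (diag_fun_linear c).

Definition diag c : Endo K := diag_fun c.

Lemma atH_diag q : atH q = diag (fun i => q.[i.+1%:R]).
Proof.
apply: (Endo_dpowP charK) => n; rewrite atH_dpow //; apply/polyP => i.
rewrite [RHS]coef_diag_fun coefZ dpow.unlock coefZ coefXn.
by case: eqP => [->|] //; rewrite !mulr0.
Qed.

Lemma diag_inverse c : (forall i, c i != 0) ->
  lin_inverse (diag c) (diag (fun i => (c i)^-1)).
Proof.
by move=> c0; split=> p; apply/polyP => i; rewrite !coef_diag_fun (mulKf, mulVKf).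
Qed.

Lemma block22_diag_inverse d c : (forall i : nat, d < i%:Z -> c i != 0) ->
  lin_inverse (block22 d (diag c)) (block22 d (diag (fun i => (c i)^-1))).
Proof.
move=> c0; split=> v; apply: val_inj; apply/polyP => i; rewrite /= coef_trunc_gt;
  (case: ltP => [di|id]; last by rewrite (in_gtP _ _ (valP v)));
  by rewrite coef_diag_fun coef_trunc_gt di coef_diag_fun ?mulKf ?mulVKf ?c0.
Qed.

End Diagonal.

(** * The Neumann series of a locally nilpotent perturbation *)
Section Neumann.
Variables (K : fieldType) (V : lmodType K) (f f0 g0 fm : {linear V -> V}).
Hypotheses (fE : forall v, f v = fm v + f0 v) (g0K : cancel g0 f0).
Let T v := g0 (fm v).

(** Since f = f0 (1 + T), this is a telescoping sum. *)
Lemma neumann_sum N w :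
  f (\sum_(i < N) (-1) ^+ i *: iter i T w) = f0 (w - (-1) ^+ N *: iter N T w).
Proof.
elim: N => [|N IH]; first by rewrite big_ord0 scale1r subrr !linear0.
rewrite big_ord_recr /= [f (_ + _)]linearD IH.
set s := (-1) ^+ N; set t := iter N T w.
have -> : f (s *: t) = f0 (s *: (T t + t)).
  by rewrite !linearZ fE linearD /= /T g0K.
rewrite -linearD; congr (f0 _).
by rewrite exprS mulN1r scaleNr opprK scalerDr [_ *: T t + _]addrC addrA subrK.
Qed.

Lemma neumann_series (g : {linear V -> V}) :
  cancel f g ->
  (forall w, exists N, forall i, (N <= i)%N -> iter i T w = 0) ->
  is_locally_finite_sum (fun i v => (-1) ^+ i *: iter i T (g0 v)) g.
Proof.
move=> fg Tnil v; have [N TN] := Tnil (g0 v); exists N; split=> [i Ni|].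
  by rewrite TN // scaler0.
by apply: (canLR fg); rewrite neumann_sum TN // scaler0 subr0 g0K.
Qed.

End Neumann.

(** * The units of the algebra *)
Section Units.
Variable K : fieldType.
Hypothesis charK : [pchar K] =i pred0.
Implicit Types (f g a u v : Endo K) (p q : {poly K}).

Lemma entryM L f g i n : (size (g (dpow K n)) <= L)%N ->
  entry (f * g) i n = \sum_(l < L) entry f i l * entry g l n.
Proof.
move=> gL; rewrite {1}/entry EndoME (dcoord_apply charK _ _ gL).
by apply: eq_bigr => l _; rewrite mulrC.
Qed.

Lemma entry1 i n : entry (1 : Endo K) i n = (i == n)%:R.
Proof. by rewrite /entry Endo1E dcoord_dpow. Qed.

Lemma I1Z k f : I1 K f -> I1 K (k *: f).
Proof.
have I1submod := GRing.submod_closed_semi (GRing.subalg_closedZ (I1_subalg K)).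
have := I1submod.2 k f; rewrite !in_setE; exact.
Qed.

Lemma I1D f g : I1 K f -> I1 K g -> I1 K (f + g).
Proof.
by have [_ /(_ 1 f g) + _] := I1_subalg K; rewrite scale1r !in_setE; apply.
Qed.

Lemma I1M f g : I1 K f -> I1 K g -> I1 K (f * g).
Proof. by have [_ _ /(_ f g)] := I1_subalg K; rewrite !in_setE. Qed.

Lemma I1_1 : I1 K 1.
Proof. by have [] := I1_subalg K; rewrite in_setE. Qed.

Lemma I1_0 : I1 K 0.
Proof. by have := I1Z 0 I1_1; rewrite scale0r. Qed.

Lemma I1_gen f : [set opX K; opD K; opI K] f -> I1 K f.
Proof. by move=> fg S [_]; apply. Qed.

Lemma I1X f n : I1 K f -> I1 K (f ^+ n).
Proof. by move=> fI; elim: n => [|n IH]; [exact: I1_1|rewrite exprS; exact: I1M]. Qed.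

Lemma I1_e i j : I1 K (e K i j).
Proof.
have II : I1 K (opI K) by apply: I1_gen; right; exact: erefl.
have ID : I1 K (opD K) by apply: I1_gen; left; right; exact: erefl.
apply: I1D; first by apply: I1M; apply: I1X.
by rewrite -scaleN1r; apply: I1Z; apply: I1M; apply: I1X.
Qed.

Lemma F_I1 f : F K f -> I1 K f.
Proof.
move=> [lam _ <-]; rewrite /Fsum; elim/big_rec: _ => [|ij g _ gI]; first exact: I1_0.
by apply: I1D gI; apply: I1Z; apply: I1_e.
Qed.

Lemma oneF_I1 f : oneF K f -> I1 K f.
Proof. by move=> [g /F_I1 gI <-]; apply: I1D gI; exact: I1_1. Qed.

Lemma F_scale k f : F K f -> F K (k *: f).
Proof.
move=> /(F_dpowP charK)[N fN]; apply/(F_dpowP charK); exists N => n Nn.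
by rewrite EndoZE fN // scaler0.
Qed.

Lemma units_Aut u : units (I1 K) u -> Aut K u.
Proof.
move=> [_ [v _ [uv vu]]]; exists v; split=> p.
  by rewrite -EndoME vu.
by rewrite -EndoME uv.
Qed.

(** All indices of an automorphism are nonpositive, so its lowest index is the
    opposite of a natural number. *)
Lemma unit_bottom f : I1 K f -> Aut K f ->
  exists r : nat, coefH f (- r%:Z) != 0 /\
    forall k : int, k < - r%:Z -> coefH f k = 0.
Proof.
move=> fI fA; have [|m cm cbot] := @cf_bottom _ (canform f).
  by rewrite (canformK charK fI); apply: Aut_not_F.
have [_ ctop] := Aut_coefH charK fI fA.
have [m0|/ctop] := leP m 0; last by move/eqP: cm.
by exists `|m|%N; have -> : - `|m|%N%:Z = m by lia.
Qed.

(** Modulo [F] the algebra is a ring of skew Laurent polynomials over K[H], in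
    which the lowest coefficient of a product is the (twisted) product of the
    lowest coefficients. *)
Lemma unit_scalar_mod_F u : units (I1 K) u ->
  exists2 k, k != 0 & F K (u - k *: 1).
Proof.
move=> uU; have [uI [v vI [uv vu]]] := uU.
have uA := units_Aut uU.
have vA : Aut K v by apply: units_Aut; split=> //; exists u.
have [r [cr rbot]] := unit_bottom uI uA; have [s [cs sbot]] := unit_bottom vI vA.
have [_ utop] := Aut_coefH charK uI uA.
have [R lu0] := fsfun_nat2_bound (canform u).2.
have [S lv0] := fsfun_nat2_bound (canform v).2.
have uE i n : entry u i n =
    (coefH u (i%:Z - n%:Z)).[(minn i n).+1%:R] + (canform u).2 (i, n).
  by rewrite -{1}(canformK charK uI) entry_cf_eval.
have vE i n : entry v i n =
    (coefH v (i%:Z - n%:Z)).[(minn i n).+1%:R] + (canform v).2 (i, n).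
  by rewrite -{1}(canformK charK vI) entry_cf_eval.
(* Between column n + r + s of v and row n of u only the index n + r
   contributes: v vanishes above it and u vanishes to the right of it. *)
have low n : (R <= n)%N -> (S <= n)%N ->
    (n == n + (r + s))%N%:R =
    (coefH u (- r%:Z)).[n.+1%:R] * (coefH v (- s%:Z)).[(n + r).+1%:R].
  move=> Rn Sn; rewrite -entry1 -uv.
  pose L := maxn (size (v (dpow K (n + (r + s))))) (n + r).+1.
  have nL : (n + r < L)%N by rewrite leq_maxr.
  rewrite (entryM _ _ (leq_maxl _ _ : _ <= L)%N) (bigD1 (Ordinal nL)) //=.
  rewrite big1 ?addr0 => [|l lnr].
    rewrite uE vE lu0 ?Rn // lv0 ?(leq_trans Sn) ?leq_addr // !addr0.
    rewrite (_ : n%:Z - (n + r)%N%:Z = - r%:Z); last lia.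
    rewrite (_ : (n + r)%N%:Z - (n + (r + s))%N%:Z = - s%:Z); last lia.
    by congr (_.[_%:R] * _.[_%:R]); lia.
  have [ltl|gtl] : (l < n + r)%N \/ (n + r < l)%N.
    by move: lnr; rewrite -val_eqE /= neq_ltn => /orP.
    by rewrite vE sbot ?horner0 ?lv0 ?addr0 ?mulr0 //; lia.
  by rewrite uE rbot ?horner0 ?lu0 ?addr0 ?mul0r //; lia.
have [Q crQ] := poly_nonroot charK cr; have [Q' csQ] := poly_nonroot charK cs.
have rs0 : (r + s = 0)%N.
  have := low (R + S + Q + Q')%N; set n := (_ + Q')%N.
  have /negPf crn : (coefH u (- r%:Z)).[n.+1%:R] != 0 by apply: crQ; lia.
  have /negPf csn : (coefH v (- s%:Z)).[(n + r).+1%:R] != 0 by apply: csQ; lia.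
  move=> H; apply/eqP; move: (H ltac:(lia) ltac:(lia)).
  rewrite -{1}[n]addn0 eqn_add2l eq_sym; case: eqP => // _ /esym/eqP.
  by rewrite mulf_eq0 crn csn.
have [r0 s0] : r = 0%N /\ s = 0%N by lia.
have prod1 : coefH u 0 * coefH v 0 = 1.
  apply/eqP; rewrite -subr_eq0; apply/negP => /negP/(poly_nonroot charK)[T hT].
  have := low (R + S + T)%N; have := hT (R + S + T).+1; set n := (_ + T)%N.
  rewrite r0 s0 oppr0 !addn0 eqxx !hornerE => hn lown.
  by move: (hn ltac:(lia)); rewrite -lown ?subrr ?eqxx //; lia.
have /size_poly1P[k k0 ck] : size (coefH u 0) == 1%N.
  have /unitrPr : exists y, coefH u 0 * y = 1 by exists (coefH v 0).
  by rewrite poly_unitE => /andP[].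
exists k => //; exists (canform u).2 => //.
apply: (Endo_entryP charK) => i n; rewrite entry_Fsum //.
rewrite -scaleNr entryD entryZ entry1 uE.
case: (ltngtP i n) => [ltin|gtin|->].
- by rewrite mulr0 addr0 rbot ?horner0 ?add0r //; lia.
- by rewrite mulr0 addr0 utop ?horner0 ?add0r //; lia.
- by rewrite subrr ck hornerC mulr1 addrAC subrr add0r.
Qed.

Lemma units_I1 :
  units (I1 K) = [set k *: u | k in [set k : K | k != 0] & u in units (oneF K)].
Proof.
apply/seteqP; split=> u.
  move=> uU; have [uI [v vI [uv vu]]] := uU.
  have vU : units (I1 K) v by split=> //; exists u.
  have [k k0 Fu] := unit_scalar_mod_F uU; have [l l0 Fv] := unit_scalar_mod_F vU.
  have kl : k * l = 1.
    have [N HN] := (F_dpowP charK _).1 Fu; have [M HM] := (F_dpowP charK _).1 Fv.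
    pose n := (N + M)%N.
    have un : u (dpow K n) = k *: dpow K n.
      by apply/eqP; rewrite -subr_eq0; apply/eqP/(HN n); lia.
    have vn : v (dpow K n) = l *: dpow K n.
      by apply/eqP; rewrite -subr_eq0; apply/eqP/(HM n); lia.
    have := congr1 (fun f : Endo K => dcoord n (f (dpow K n))) uv.
    by rewrite EndoME Endo1E vn linearZ un !dcoordZ dcoord_dpow // eqxx mulr1 mulrC.
  have kV : k^-1 = l by rewrite -[l](mulKf k0) kl mulr1.
  exists k => //; exists (k^-1 *: u); last by rewrite scalerA divff ?scale1r.
  have inF w m m' : m * m' = 1 -> F K (w - m *: 1) -> oneF K (m' *: w).
    move=> mm Fw; exists (m' *: (w - m *: 1)); first exact: F_scale.
    by rewrite scalerBr scalerA mulrC mm scale1r addrC subrK.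
  split; first by rewrite kV; apply: inF Fu.
  exists (k *: v); first by apply: inF Fv; rewrite mulrC.
  by rewrite -!scalerAl -!scalerAr !scalerA mulVf // mulfV // !scale1r.
move=> [k /= k0 [w [wF [w' w'F [ww' w'w]]] <-]].
split; first by apply: I1Z; apply: oneF_I1.
exists (k^-1 *: w'); first by apply: I1Z; apply: oneF_I1.
by rewrite -!scalerAl -!scalerAr !scalerA mulVf // mulfV // !scale1r.
Qed.

Lemma Aut_opH : Aut K (opH K).
Proof.
have -> : opH K = diag (fun i => i.+1%:R).
  have -> : opH K = atH 'X by rewrite /atH horner_algX.
  rewrite (atH_diag charK).
  by apply: EndoP => p; apply/polyP => i; rewrite !coef_diag_fun hornerX.
by eexists; apply: diag_inverse => i; apply: natf_neq0S.
Qed.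

Lemma units_proper : units (I1 K) `<` I1 K `&` Aut K.
Proof.
split=> [u uU|all_units]; first by split; [case: uU|exact: units_Aut].
have [k k0 /(F_dpowP charK)[N HN]] : exists2 k, k != 0 & F K (opH K - k *: 1).
  apply: unit_scalar_mod_F; apply: all_units; split; last exact: Aut_opH.
  by apply: I1M; apply: I1_gen; left; [right|left]; exact: erefl.
have kE n : (N <= n)%N -> n.+1%:R = k.
  move=> /HN/(congr1 (dcoord n)); 
  rewrite EndoBE EndoZE Endo1E opH_dpow // dcoordB !dcoordZ.
  by rewrite dcoord_dpow // eqxx !mulr1 linear0 => /eqP; rewrite subr_eq0 => /eqP.
by have := kE _ (leqnSn N); rewrite -(kE _ (leqnn N)) => /(natf_inj charK); lia.
Qed.

End Units.

(** * Operators without integration terms *)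
Section Main.
Variable K : fieldType.
Hypothesis charK : [pchar K] =i pred0.
Variable a : Endo K.
Variable D : nat.
Hypothesis lam0 : forall i n, (D <= i)%N || (D <= n)%N -> (canform a).2 (i, n) = 0.
Local Notation d := (D%:Z - 1).
Implicit Types p q : {poly K}.

Lemma in_leE p : in_le d p = (size p <= D)%N.
Proof. exact: in_le_size. Qed.

Section Triangular.
Hypothesis aE : a = part_minus a + part_zero a + part_F a.

Lemma triangular_entry i n : (n < i)%N -> (D <= i)%N -> entry a i n = 0.
Proof.
move=> ni Di; rewrite aE !entryD entry_part_minus // entry_part_zero // entry_part_F //.
by rewrite lam0 ?Di // ltnNge ltnW //= gtn_eqF // mul0r !addr0.
Qed.

Lemma diagonal_entry n : (D <= n)%N -> entry a n n = (coefH a 0).[n.+1%:R].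
Proof.
move=> Dn; rewrite {1}aE !entryD entry_part_minus // entry_part_zero // entry_part_F //.
by rewrite lam0 ?Dn // ltnn eqxx mul1r add0r addr0.
Qed.

Lemma size_bounded_stable N : (D <= N)%N -> size_bounded a N N.
Proof.
move=> DN; apply: (entries_size_bounded charK) => i n Ni nN.
by apply: triangular_entry; [exact: leq_trans nN Ni|exact: leq_trans DN Ni].
Qed.

Lemma triangular_shifts :
  (forall s : nat, (D <= s)%N -> (coefH a 0).[s.+1%:R] != 0) -> shifts a D D.
Proof.
move=> a0; apply: (entries_shifts charK) => [i n Di|n].
  by rewrite ltn_add2r => ni; apply: triangular_entry.
by rewrite diagonal_entry ?a0 ?leq_addl.
Qed.

(** A zero diagonal entry in position s >= D would make [a] map K[x]_{<=s}
    into K[x]_{<s}, against injectivity. *)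
Lemma injective_nonroot s :
  injective a -> (D <= s)%N -> (coefH a 0).[s.+1%:R] != 0.
Proof.
move=> ainj Ds; rewrite -diagonal_entry //; apply/eqP => ass.
suff /size_bounded_inj_leq/(_ ainj) : size_bounded a s.+1 s by rewrite ltnn.
apply: (entries_size_bounded charK) => i n Ni ns.
have [iEn|iNn] := eqVneq i n.
  have sE : s = n by apply/eqP; rewrite eqn_leq -{1}iEn Ni -ltnS ns.
  by rewrite iEn -sE.
apply: triangular_entry; last exact: leq_trans Ni.
by rewrite ltn_neqAle eq_sym iNn (leq_trans _ Ni).
Qed.

(** An injective operator that preserves the finite dimensional K[x]_{<D} is
    onto it, so its inverse preserves it as well. *)
Lemma inverse_stable g : lin_inverse a g -> size_bounded g D D.
Proof.
move=> [ag ga] p pD.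
have [q qD <-] := size_bounded_inj_onto (size_bounded_stable (leqnn D)) (can_inj ag) pD.
by rewrite ag.
Qed.

(** Outside the corner [a] preserves degrees, so bijectivity is decided on
    the corner, where it is that of [b]. *)
Lemma triangular_Aut (b : {linear pol_le K d -> pol_le K d}) :
  restricts_to a b -> lin_invertible b ->
  (forall s : nat, (D <= s)%N -> (coefH a 0).[s.+1%:R] != 0) -> Aut K a.
Proof.
move=> ab [c [bc cb]] /triangular_shifts aD; apply: bij_Aut.
  apply: (shifts_inj aD) => p pD ap.
  have pin : in_le d p by rewrite in_leE.
  have : b (PolLe pin) = 0 by apply: val_inj; rewrite ab.
  move/(congr1 c); rewrite bc linear0; exact: (congr1 val).
apply: (shifts_surj aD) => q qD.
have qin : in_le d q by rewrite in_leE.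
by exists (val (c (PolLe qin))); rewrite -ab cb.
Qed.

Lemma part_F_gt (v : pol_gt K d) : part_F a (val v) = 0.
Proof.
apply: (dcoordP charK) => i; rewrite (dcoord_apply charK _ _ (leqnn _)) linear0.
rewrite big1 // => n _; rewrite entry_part_F //.
have [Dn|nD] := leqP D n; first by rewrite lam0 ?Dn ?orbT ?mulr0.
have /eqP : (val v)`_n = 0 by apply: (in_gtP _ _ (valP v)); lia.
by rewrite -dcoord_eq0 // => /eqP ->; rewrite mul0r.
Qed.

End Triangular.

Lemma size_part_minus N : size_bounded (part_minus a) N N.-1.
Proof.
apply: (entries_size_bounded charK) => i n Ni nN.
by rewrite entry_part_minus // ltnNge (_ : (n <= i)%N) //; lia.
Qed.

Lemma size_part_zero N : size_bounded (part_zero a) N N.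
Proof.
apply: (entries_size_bounded charK) => i n Ni nN.
by rewrite entry_part_zero // gtn_eqF ?mul0r // (leq_trans nN).
Qed.

(** In a column n > d only the band contributes to the rows i <= d, and the
    band has finite width. *)
Lemma finite_block12 : I1 K a -> ~ F K a ->
  finite_set [set ij : nat * nat |
    d < ij.2%:Z /\ (val (block12 d a (proj_gt d 'X^(ij.2))))`_ij.1 != 0].
Proof.
move=> aI aF; have aE := canformK charK aI.
have [|m cm cbot] := @cf_bottom _ (canform a); first by rewrite aE.
apply: (@sub_finite_set _ _ (`I_D `*` `I_(D + `|m|)%N)); last first.
  exact: finite_setX.
move=> [i j] /= [dj]; rewrite coef_trunc_le; case: ifP => [id|_]; last by rewrite eqxx.
have -> : trunc_gt d 'X^j = 'X^j :> {poly K}.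
  apply/polyP => l; rewrite coef_trunc_gt coefXn.
  by case: ltP => // ld; case: eqP => // lj; lia.
rewrite -dcoord_eq0 //.
have -> : 'X^j = j`!%:R *: dpow K j.
  by rewrite dpow.unlock scalerA mulfV ?scale1r ?factf_neq0.
rewrite linearZ dcoordZ -/(entry a i j) mulf_eq0 (negPf (factf_neq0 charK j)) /=.
rewrite -{1}aE entry_cf_eval // lam0; last by apply/orP; right; lia.
rewrite addr0 => aij; split; first lia.
suff : m <= i%:Z - j%:Z by lia.
by rewrite leNgt; apply: contraNN aij => /cbot ->; rewrite horner0.
Qed.

End Main.

(** * Automorphisms, units and the inversion formula *)
Theorem theorem6p2 (K : fieldType) (charK : [pchar K] =i pred0)
    (a : Endo K) (aI : I1 K a) (aNF : ~ F K a) :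
  let d := degF a in
  [/\ (* (1) *)
      Aut K a <->
      [/\ a = part_minus a + part_zero a + part_F a,
          exists2 b : {linear pol_le K d -> pol_le K d},
            restricts_to a b & lin_invertible b,
          coefH a 0 != 0
        & forall s : nat, d < s%:Z -> ~~ root (coefH a 0) s.+1%:R],
      (* (2) *)
      units (I1 K) `<` I1 K `&` Aut K /\
      units (I1 K) =
        [set k *: u | k in [set k : K | k != 0] & u in units (oneF K)],
      (* (3) *)
      ind a = 0 ->
      [<-> injective a; forall q, exists p, a p = q; bijective a]
    & (* (4) *)
      Aut K a -> a = part_minus a + part_zero a + part_F a ->
      let a11 := block11 d a in
      let a12 := block12 d a in
      let a22 := block22 d a in
      let am := block22 d (part_minus a) in
      let a0 := block22 d (part_zero a) in
      [/\ a = block_map a11 a12 \0 a22,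
          restricts_to a a11,
          [/\ induces a a22, induces (part_minus a + part_zero a) a22,
              induces (part_minus a) am & induces (part_zero a) a0],
          finite_set [set ij : nat * nat |
            d < ij.2%:Z /\ (val (a12 (proj_gt d 'X^(ij.2))))`_ij.1 != 0]
        & exists (b11 : {linear pol_le K d -> pol_le K d})
                 (b22 b0 : {linear pol_gt K d -> pol_gt K d}),
          [/\ lin_inverse a11 b11, lin_inverse a22 b22 &
              lin_inverse a0 b0] /\
          [/\ lin_inverse a
                (block_map b11 (\- (b11 \o a12 \o b22)) \0 b22),
              locally_nilpotent (b0 \o am)
            & is_locally_finite_sum
                (fun i v => (-1) ^+ i *: iter i (b0 \o am) (b0 v)) b22]]].
Proof.
move=> d; have [D [dE lam0]] : exists D : nat, d = D%:Z - 1 /\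
  forall i n, (D <= i)%N || (D <= n)%N -> (canform a).2 (i, n) = 0.
  exact: degFP.
clearbody d; subst d; set d := D%:Z - 1.
have in_sizeE := @in_le_size K d D ^~ (erefl d).
have stableP (f : Endo K) : size_bounded f D D -> le_stable d f.
  by move=> fD p; rewrite !in_sizeE; apply: fD.
have [N [M aNM]] := I1_shifts charK aI aNF.
split.
- split=> [aA|[aE [b ab bI] _ nr]]; last first.
    apply: (triangular_Aut charK lam0 aE ab bI) => s Ds.
    by apply: nr; rewrite /d; lia.
  have [a0 _] := Aut_coefH charK aI aA; have aE := Aut_parts charK aI aA.
  have ainj := bij_inj (Aut_bij aA); have [g ag] := aA.
  have aS := stableP _ (size_bounded_stable charK lam0 aE (leqnn D)).
  have gs := stableP _ (inverse_stable charK lam0 aE ag).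
  split=> // [|s ds]; last first.
    by apply: (injective_nonroot charK lam0 aE ainj); rewrite /d in ds; lia.
  exists (block11 d a); first exact: restricts_block11.
  by exists (block11 d g); apply: block11_inverse.
- by split; [exact: units_proper|exact: units_I1].
- move=> /(ind0_inj_surj aNM) injsurj; tfae.
  + by move/injsurj.
  + by move=> asurj; apply/Aut_bij/bij_Aut => //; apply/injsurj.
  + exact: bij_inj.
move=> aA aE a11 a12 a22 am a0.
have ainj := bij_inj (Aut_bij aA); have [g ag] := aA.
have aS := stableP _ (size_bounded_stable charK lam0 aE (leqnn D)).
have gs := stableP _ (inverse_stable charK lam0 aE ag).
have ms : le_stable d (part_minus a).
  apply: stableP => p pD.
  exact: leq_trans (@size_part_minus _ charK a _ _ pD) (leq_pred _).
have zs : le_stable d (part_zero a) by apply: stableP; apply: size_part_zero.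
have a22E v : a22 v = am v + a0 v.
  rewrite /a22 /am /a0 /= {1}aE !EndoDE (part_F_gt charK lam0) addr0.
  by rewrite linearD.
have nonroot i : d < i%:Z -> (coefH a 0).[i.+1%:R] != 0.
  by move=> di; apply: (injective_nonroot charK lam0 aE ainj); rewrite /d in di; lia.
split=> //.
- exact: block_map_id.
- exact: restricts_block11.
- split; try exact: induces_block22.
  move=> p; rewrite a22E /am /a0 (induces_block22 ms) (induces_block22 zs).
  by rewrite -linearD.
- exact: finite_block12.
pose b11 := block11 d g; pose b22 := block22 d g.
pose b0 := block22 d (diag (fun i => ((coefH a 0).[i.+1%:R])^-1)).
have a0b0 : lin_inverse a0 b0.
  by rewrite /a0 /part_zero (atH_diag charK); apply: block22_diag_inverse.
have a11b11 : lin_inverse a11 b11 by apply: block11_inverse.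
have a22b22 : lin_inverse a22 b22 by apply: block22_inverse.
have size_T v : (size (val (b0 (am v))) <= (size (val v)).-1)%N.
  apply/leq_sizeP => i vi; rewrite /= coef_trunc_gt; case: ifP => // _.
  rewrite coef_diag_fun coef_trunc_gt; case: ifP; rewrite ?mulr0 // => _.
  rewrite [X in _ * X]nth_default ?mulr0 // (leq_trans _ vi) //.
  exact: (@size_part_minus _ charK a _ _ (leqnn _)).
have size_iter v i : (size (val (iter i (b0 \o am) v)) <= size (val v) - i)%N.
  elim: i => [|i IH]; first by rewrite subn0.
  by apply: leq_trans (size_T _) _; rewrite subnS -!subn1; apply: leq_sub2r.
have Tnil (v : pol_gt K d) i : (size (val v) <= i)%N -> iter i (b0 \o am) v = 0.
  move=> vi; apply: val_inj; apply/eqP; rewrite -size_poly_leq0.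
  by apply: leq_trans (size_iter _ _) _; rewrite leqn0 subn_eq0.
exists b11, b22, b0; split; first by split.
split.
- by rewrite {1}(block_map_id aS); apply: block_map_inverse.
- by move=> v; exists (size (val v)).+1 => //; apply: Tnil.
- apply: (neumann_series a22E a0b0.2 a22b22.1) => w.
  by exists (size (val w)) => i; apply: Tnil.
Qed.
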